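(* Let $d,n$ be integers with $1\le n\le d-1$ and let $g\in L_2(\mathbb B^n)$. Put $\boldsymbol u=[n]=\{1,\dots,n\}$. Then the following are equivalent. (i) $g$ satisfies both families of integral conditions: $$0=\int_{\mathbb B^{|\boldsymbol u\setminus\boldsymbol a|}}\left(1-\|\boldsymbol x_{\boldsymbol u\setminus\boldsymbol a}\|^2\right)^{(d-n-1)/2}g\Big(\boldsymbol y_{\boldsymbol a},\sqrt{1-\|\boldsymbol y_{\boldsymbol a}\|^2}\,\boldsymbol x_{\boldsymbol u\setminus\boldsymbol a}\Big)\,\mathrm d\boldsymbol x_{\boldsymbol u\setminus\boldsymbol a}$$ for all $\boldsymbol a\subset\boldsymbol u$ and all $\boldsymbol y_{\boldsymbol a}\in\mathbb B^{|\boldsymbol a|}$; and $$0=\sqrt{1-\|\boldsymbol y_{\boldsymbol a}\|^2-r^2}\int_{\mathbb B^{|\boldsymbol u\setminus\boldsymbol a|}}\left(1-\|\boldsymbol x_{\boldsymbol u\setminus\boldsymbol a}\|^2\right)^{m/2}g\Big(\boldsymbol y_{\boldsymbol a},\sqrt{1-\|\boldsymbol y_{\boldsymbol a}\|^2-r^2}\,\boldsymbol x_{\boldsymbol u\setminus\boldsymbol a}\Big)\,\mathrm d\boldsymbol x_{\boldsymbol u\setminus\boldsymbol a}$$ for all $\boldsymbol a\subset\boldsymbol u$, all $\boldsymbol y_{\boldsymbol a}\in\mathbb B^{|\boldsymbol a|}$, all $0\le r\le\sqrt{1-\|\boldsymbol y_{\boldsymbol a}\|^2}$ and all integers $m\in\{-1,0,1,\dots,d-n-2\}$.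 (ii) $g$ is odd in every direction: for every $i\in[n]$, $g(\boldsymbol x)=-g(\boldsymbol x_{[n]\setminus i},-x_i)$ for almost all $\boldsymbol x\in\mathbb B^n$.
   Context: $\mathbb B^k$ is the closed Euclidean unit ball of $\mathbb R^k$ ($\mathbb B^0$ is a single point), $L_2(\mathbb B^n)$ is taken with respect to Lebesgue measure and consists of real-valued functions. For an index set $\boldsymbol a$, $\boldsymbol x_{\boldsymbol a}=(x_i)_{i\in\boldsymbol a}$; $\boldsymbol a\subset\boldsymbol u$ means proper subset ($\boldsymbol a=\varnothing$ allowed, in which case $\|\boldsymbol y_\varnothing\|=0$). $g(\boldsymbol y_{\boldsymbol a},\boldsymbol z_{\boldsymbol u\setminus\boldsymbol a})$ is $g$ evaluated at the vector with $\boldsymbol a$-part $\boldsymbol y_{\boldsymbol a}$ and $(\boldsymbol u\setminus\boldsymbol a)$-part $\boldsymbol z_{\boldsymbol u\setminus\boldsymbol a}$; $(\boldsymbol x_{[n]\setminus i},-x_i)$ is $\boldsymbol x$ with the sign of the $i$-th coordinate flipped. Since $g$ is an $L_2$-function, the conditions in (i) are understood for almost all values of the parameters $\boldsymbol y_{\boldsymbol a}$ and $r$. *)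

(* Defs.v *)
From HB Require Import structures.
From mathcomp Require Import all_boot all_order all_algebra.
From mathcomp Require Import all_classical all_reals all_analysis.

Set Implicit Arguments.
Unset Strict Implicit.
Unset Printing Implicit Defensive.

Import Order.TTheory GRing.Theory Num.Theory.
Import numFieldNormedType.Exports.

Local Open Scope classical_set_scope.
Local Open Scope ring_scope.

(* Vectors of R^k are k.-tuple R, with the library's product sigma-algebra.  *)

Section lebesgue_cons.
Local Open Scope ereal_scope.
Context {R : realType} (k : nat).
Variable mu : {sigma_finite_measure set (k.-tuple R) -> \bar R}.

Definition cons_pair (p : measurableTypeR R * k.-tuple R) : k.+1.-tuple R :=
  [tuple of p.1 :: p.2].

Lemma measurable_cons_pair : measurable_fun [set: _] cons_pair.
Proof.
by apply: (@measurable_cons _ _ (measurableTypeR R * k.-tuple R)%type R).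
Qed.

Definition lebesgue_cons : set (k.+1.-tuple R) -> \bar R :=
  pushforward (lebesgue_measure \x mu) cons_pair.

HB.instance Definition _ := Measure.copy lebesgue_cons
  (measure_function_pushforward__canonical__measure_function_Measure
     (lebesgue_measure \x mu) measurable_cons_pair).

Let lebesgue_cons_sigma_finite : sigma_finite setT lebesgue_cons.
Proof.
have /sigma_finiteP[F [TF ndF Foo]] :=
  sigma_finiteT (@lebesgue_measure R : {sigma_finite_measure set _ -> \bar R}).
have /sigma_finiteP[G [TG ndG Goo]] := sigma_finiteT mu.
pose h (t : k.+1.-tuple R) : measurableTypeR R * k.-tuple R :=
  (thead t, [tuple of behead t]).
have mh : measurable_fun [set: _] h.
  by apply/measurable_fun_pairP; split;
    [exact: measurable_tnth|exact: measurable_behead].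
exists (fun i => h @^-1` (F i `*` G i)).
  apply/esym; rewrite -subTset => t _.
  have [p _ Fp] : (\bigcup_i F i) (h t).1 by rewrite -TF.
  have [q _ Gq] : (\bigcup_i G i) (h t).2 by rewrite -TG.
  exists (maxn p q) => //; split.
  - by move: Fp; exact/subsetPset/ndF/leq_maxl.
  - by move: Gq; exact/subsetPset/ndG/leq_maxr.
move=> i; have [mF Fioo] := Foo i; have [mG Gioo] := Goo i; split.
  by rewrite -[X in measurable X]setTI; apply: mh => //; exact: measurableX.
rewrite /lebesgue_cons /pushforward -comp_preimage.
rewrite (_ : h \o cons_pair = id); last first.
  by apply/funext => -[x t]; congr pair; exact/val_inj.
by rewrite preimage_id product_measure1E// lte_mul_pinfty// ge0_fin_numE.
Qed.

HB.instance Definition _ := @Measure_isSigmaFinite.Build _ _ _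
  lebesgue_cons lebesgue_cons_sigma_finite.

End lebesgue_cons.

(* Lebesgue measure on the Borel sets of R^k; on R^0 it is the unit mass.    *)
Fixpoint lebesgue_tuple (R : realType) (k : nat) :
    {sigma_finite_measure set (k.-tuple R) -> \bar R} :=
  if k is k'.+1 then lebesgue_cons (lebesgue_tuple R k')
  else dirac ([tuple] : 0.-tuple R).

Section euclidean.
Context {R : realType} {k : nat}.
Implicit Types x : k.-tuple R.

Definition enorm x : R := Num.sqrt (\sum_(i < k) tnth x i ^+ 2).

Definition unit_ball : set (k.-tuple R) := [set x | enorm x <= 1].

Definition dilate (c : R) x : k.-tuple R := [tuple c * tnth x i | i < k].

Definition flip (i : 'I_k) x : k.-tuple R :=
  [tuple if j == i then - tnth x j else tnth x j | j < k].

(* L_2(B^k): g is represented by a function on R^k of which only the values  *)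
(* on the ball matter: its extension by 0 has to be in L_2(R^k). As the      *)
(* library's Lfun, this is a set of functions, not of classes.               *)
Definition L2_ball (g : k.-tuple R -> R) : Prop :=
  g \_ unit_ball \in Lfun (lebesgue_tuple R k) 2%:E.

End euclidean.

(* The vector with a-part y and (~: a)-part z; the coordinates of y (resp.   *)
(* z) are numbered by the increasing enumeration of a (resp. ~: a).          *)
Definition splice (R : realType) (n : nat) (a : {set 'I_n})
    (y : #|a|.-tuple R) (z : #|~: a|.-tuple R) : n.-tuple R :=
  [tuple if i \in a then nth 0 y (index i (enum a))
         else nth 0 z (index i (enum (~: a))) | i < n].

(* Main.v *)
Require Import Defs.
From HB Require Import structures.
From mathcomp Require Import all_boot all_order all_algebra.
From mathcomp Require Import all_classical all_reals all_analysis.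
From mathcomp Require Import measurable_realfun ring lra.

Import Order.TTheory GRing.Theory Num.Theory.
Import numFieldNormedType.Exports.

Local Open Scope classical_set_scope.
Local Open Scope ring_scope.

(** Let [G] be [g] extended by 0 outside the ball; it is integrable, because it
is square integrable and the ball has finite measure.

From oddness to the integral conditions: since [a] is a proper subset, some
direction [i] lies outside [a]. For almost every [y] the slice
[z |-> G (splice y z)] changes sign when its [i]-th coordinate does, and the
weights are radial, so the integrand is antisymmetric under a reflection that
preserves Lebesgue measure, and its integral vanishes ([integral_antisym]).
This only makes sense if the integrand is integrable, since the integral of an
antisymmetric function of infinite mass is [-oo] by convention. For a nonnegative exponent
the weight is bounded and integrability follows from Tonelli's theorem. For
the exponent -1/2 it holds for almost every [(y, r)], because
[(1 - |y|^2 - r^2 - |z|^2)^(-1/2)] integrated over [r > 0] gives at most pi/2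
([ae_abel_integrable]).

From the integral conditions to oddness: the second family with [m = -1] and
[a] the complement of [{i}] suffices. The inner integral is then over a
segment and reads, after rescaling and with [c = 1 - |y|^2],
[\int (c - r^2 - s^2)^(-1/2) h s ds = 0] for almost every [r], where [h] is the
slice of [G] above [y]. This is an Abel transform of the even part of [h]. It
is inverted by integrating against [r (r^2 - b)^(-1/2)] over [r > sqrt b]: the
elementary integral
[\int_(b < r^2 < t) r (r^2 - b)^(-1/2) (t - r^2)^(-1/2) dr = pi/2]
does not depend on [t], so Fubini's theorem turns the Abel integrals into plain
integrals of [h] over the segments [s^2 < c - b] ([abel_inversion]). A function
whose integrals over all centred segments vanish is odd almost everywhere, by
Lebesgue's differentiation theorem ([ae_odd]). Integrating over [y] gives the
oddness of [g] in direction [i].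

Lebesgue measure on tuples is defined by adding one coordinate at a time, so
everything rests on [ge0_integral_splice], Tonelli's theorem for an arbitrary
partition of the coordinates into two groups. *)

(** * Lebesgue measure on tuples: Tonelli and dilations *)

Lemma ge0_integral_cons (R : realType) (k : nat) (f : k.+1.-tuple R -> \bar R) :
  measurable_fun setT f -> (forall x, 0 <= f x)%E ->
  (\int[lebesgue_tuple R k.+1]_x f x =
   \int[lebesgue_measure]_s \int[lebesgue_tuple R k]_t f (cons_pair (s, t)))%E.
Proof.
move=> mf f0.
rewrite [LHS](ge0_integral_pushforward (@measurable_cons_pair R k))//=.
rewrite preimage_setT fubini_tonelli1//.
exact: measurableT_comp mf (@measurable_cons_pair R k).
Qed.

Lemma ge0_integral_cons_swap (R : realType) (k : nat)
    (f : k.+1.-tuple R -> \bar R) :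
  measurable_fun setT f -> (forall x, 0 <= f x)%E ->
  (\int[lebesgue_tuple R k.+1]_x f x =
   \int[lebesgue_tuple R k]_t \int[lebesgue_measure]_s f (cons_pair (s, t)))%E.
Proof.
move=> mf f0; rewrite ge0_integral_cons//.
apply: (fubini_tonelli (fun p => f (cons_pair p))) => //.
exact: measurableT_comp mf (@measurable_cons_pair R k).
Qed.

Lemma ge0_integral_tuple0 (R : realType) (f : 0.-tuple R -> \bar R) :
  measurable_fun setT f ->
  (\int[lebesgue_tuple R 0]_x f x = f [tuple])%E.
Proof. by move=> mf; rewrite integral_dirac// diracT mul1e. Qed.

(** Meant for [q = #|~: a|] with [a] the complement of a singleton, which equals 1
without being convertible to it; constant tuples avoid a cast. *)
Lemma ge0_integral_tuple1 (R : realType) (q : nat) (f : q.-tuple R -> \bar R) :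
  q = 1%N -> measurable_fun setT f -> (forall x, 0 <= f x)%E ->
  (\int[lebesgue_tuple R q]_x f x =
   \int[lebesgue_measure]_s f [tuple s | _ < q])%E.
Proof.
move=> q1; subst q => mf f0; rewrite ge0_integral_cons//.
apply: eq_integral => s _; rewrite ge0_integral_tuple0//.
  congr f; apply: eq_from_tnth => i; rewrite tnth_mktuple ord1.
  by rewrite (tnth_nth 0).
apply: measurableT_comp mf _.
apply: measurableT_comp (@measurable_cons_pair R 0) _.
by apply/measurable_fun_pairP; split; [exact: measurable_cst|exact: measurable_id].
Qed.

Lemma measurable_mull (R : realType) (c : R) :
  measurable_fun setT ( *%R c : measurableTypeR R -> measurableTypeR R).
Proof. exact: mulrl_measurable. Qed.

Lemma lebesgue_measure_scale (R : realType) (c : R)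
    (A : set (measurableTypeR R)) : 0 < c -> measurable A ->
  lebesgue_measure A = (c%:E * lebesgue_measure ( *%R c @^-1` A))%E.
Proof.
move=> c0 mA.
pose phi : {measure set (measurableTypeR R) -> \bar R} :=
  mscale (NngNum (ltW c0))
   (measure_function_pushforward__canonical__measure_function_Measure
     lebesgue_measure (measurable_mull R c)).
rewrite (_ : (_ * _)%E = phi A)//.
apply: lebesgue_measure_unique => //= _ [[a b]] _ <-.
rewrite /mscale/= /pushforward.
rewrite (_ : _ @^-1` _ = [set` `]a / c, b / c]]); last first.
  apply/seteqP; split => s /=; rewrite !in_itv/= ltr_pdivrMr// ler_pdivlMr//;
  by rewrite mulrC.
rewrite !lebesgue_measure_itv/= !lte_fin ltr_pM2r ?invr_gt0//.
case: ifPn => ab; last by rewrite mule0.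
by rewrite -EFinD -EFinM -mulrBl mulrC divfK ?gt_eqF.
Qed.

Lemma ge0_integral_scale (R : realType) (c : R) (f : R -> \bar R) : 0 < c ->
  measurable_fun setT f -> (forall x, 0 <= f x)%E ->
  (\int[lebesgue_measure]_s f s = c%:E * \int[lebesgue_measure]_s f (c * s)%R)%E.
Proof.
move=> c0 mf f0.
rewrite -(ge0_integral_pushforward (measurable_mull R c) lebesgue_measure measurableT)//.
rewrite -[RHS](ge0_integral_mscale
   (measure_function_pushforward__canonical__measure_function_Measure
     lebesgue_measure (measurable_mull R c)) measurableT (NngNum (ltW c0)))//.
apply: eq_measure_integral => /= A mA _.
by rewrite /mscale/= /pushforward -lebesgue_measure_scale.
Qed.

Lemma ge0_integral_opp (R : realType) (f : R -> \bar R) :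
  measurable_fun setT f -> (forall x, 0 <= f x)%E ->
  (\int[lebesgue_measure]_s f (- s)%R = \int[lebesgue_measure]_s f s)%E.
Proof.
move=> mf f0.
have mo : measurable_fun setT (-%R : measurableTypeR R -> measurableTypeR R).
  exact: oppr_measurable.
rewrite -[LHS](ge0_integral_pushforward mo lebesgue_measure measurableT)//.
by apply: eq_measure_integral => /= A mA _; rewrite lebesgue_measureN.
Qed.

Section tuples.
Context {R : realType}.

Lemma measurable_fun_tuple d (T : measurableType d) k (f : T -> k.-tuple R) :
  (forall i, measurable_fun setT (fun x => tnth (f x) i)) ->
  measurable_fun setT f.
Proof. by move=> mf; apply/measurable_fun_tnthP. Qed.

Lemma measurable_dilate k (c : R) : measurable_fun setT (@dilate R k c).
Proof.
apply: measurable_fun_tuple => i.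
under eq_fun do rewrite tnth_mktuple.
by apply: measurable_funM => //; exact: measurable_tnth.
Qed.

Lemma dilate_cons k (c s : R) (t : k.-tuple R) :
  dilate c (cons_pair (s, t)) = cons_pair (c * s, dilate c t).
Proof.
apply: eq_from_tnth => i; rewrite tnth_mktuple.
by case: (unliftP ord0 i) => [j|] -> //=; rewrite !tnthS tnth_mktuple.
Qed.

Lemma measurable_cons_pairl k (s : R) :
  measurable_fun setT (fun t : k.-tuple R => cons_pair (s, t)).
Proof.
apply: measurableT_comp (@measurable_cons_pair R k) _.
exact: pair1_measurable.
Qed.

(** By induction on the dimension, each coordinate contributing one factor [c]. *)
Lemma ge0_integral_dilate k (c : R) (f : k.-tuple R -> \bar R) : 0 < c ->
  measurable_fun setT f -> (forall x, 0 <= f x)%E ->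
  (\int[lebesgue_tuple R k]_x f x =
   (c ^+ k)%:E * \int[lebesgue_tuple R k]_x f (dilate c x))%E.
Proof.
move=> c0; elim: k f => [|k IH] f mf f0.
  rewrite !ge0_integral_tuple0 ?expr0 ?mul1e//; last first.
    by apply: measurableT_comp mf _; exact: measurable_dilate.
  by congr f; apply: eq_from_tnth; case.
have mfd : measurable_fun setT (fun x => f (dilate c x)).
  by apply: measurableT_comp mf _; exact: measurable_dilate.
rewrite !ge0_integral_cons//.
transitivity (\int[lebesgue_measure]_s ((c ^+ k)%:E *
    \int[lebesgue_tuple R k]_t f (cons_pair (s, dilate c t))))%E.
  apply: eq_integral => s _; apply: (IH (fun t => f (cons_pair (s, t)))) => //.
  exact: measurableT_comp mf (measurable_cons_pairl k s).
have mF : measurable_fun setT (fun s : measurableTypeR R =>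
   \int[lebesgue_tuple R k]_t f (cons_pair (s, dilate c t)))%E.
  apply: (measurable_fun_fubini_tonelli_F (m2 := lebesgue_tuple R k)
     (fun p : measurableTypeR R * k.-tuple R => f (cons_pair (p.1, dilate c p.2)))) => //.
  apply: measurableT_comp mf _.
  apply: measurableT_comp (@measurable_cons_pair R k) _.
  apply/measurable_fun_pairP; split => /=; first exact: measurable_fst.
  exact: (measurableT_comp (measurable_dilate k c) measurable_snd).
have F0 (s : measurableTypeR R) :
    (0 <= \int[lebesgue_tuple R k]_t f (cons_pair (s, dilate c t)))%E.
  exact: integral_ge0.
have ck : (0 <= (c ^+ k)%:E)%E by rewrite lee_fin exprn_ge0 ?ltW.
transitivity ((c ^+ k)%:E * \int[lebesgue_measure]_s
    \int[lebesgue_tuple R k]_t f (cons_pair (s, dilate c t)))%E.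
  by apply: ge0_integralZl.
rewrite [X in (_ * X)%E = _](ge0_integral_scale R c _ c0 mF F0).
rewrite muleA -EFinM -exprSr; congr (_ * _)%E.
by apply: eq_integral => s _; apply: eq_integral => t _; rewrite dilate_cons.
Qed.

End tuples.

(** * Tonelli for a partition of the coordinates *)

Section merge.
Context {R : realType}.

(** [splice] with the subset replaced by its characteristic sequence [m] and
with dimensions that are free variables, so that one can induct on [m]. Entry
[i] is read at the number of earlier coordinates of its own kind. *)
Definition merge n (m : seq bool) {p q} (y : p.-tuple R) (z : q.-tuple R) :
    n.-tuple R :=
  [tuple if nth false m i then nth 0 y (count id (take i m))
         else nth 0 z (count negb (take i m)) | i < n].

Lemma measurable_nth_tuple k j : measurable_fun setT (fun x : k.-tuple R => x`_j).
Proof.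
have [jk|kj] := ltnP j k.
  rewrite (_ : (fun _ => _) = (fun x : k.-tuple R => tnth x (Ordinal jk))).
    exact: measurable_tnth.
  by apply/funext => x; rewrite (tnth_nth 0).
rewrite (_ : (fun _ => _) = cst 0); first exact: measurable_cst.
by apply/funext => x; rewrite nth_default ?size_tuple.
Qed.

Lemma measurable_merge n m p q : measurable_fun setT
  (fun yz : p.-tuple R * q.-tuple R => merge n m yz.1 yz.2).
Proof.
apply: measurable_fun_tuple => i.
under eq_fun do rewrite tnth_mktuple.
case: nth.
  exact: (measurableT_comp (measurable_nth_tuple p _) measurable_fst).
exact: (measurableT_comp (measurable_nth_tuple q _) measurable_snd).
Qed.

Lemma merge_consl n m p q s (y : p.-tuple R) (z : q.-tuple R) :
  merge n.+1 (true :: m) (cons_pair (s, y)) z = cons_pair (s, merge n m y z).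
Proof.
apply: eq_from_tnth => i; rewrite tnth_mktuple.
by case: (unliftP ord0 i) => [j|] -> //=; rewrite !tnthS tnth_mktuple.
Qed.

Lemma merge_consr n m p q s (y : p.-tuple R) (z : q.-tuple R) :
  merge n.+1 (false :: m) y (cons_pair (s, z)) = cons_pair (s, merge n m y z).
Proof.
apply: eq_from_tnth => i; rewrite tnth_mktuple.
by case: (unliftP ord0 i) => [j|] -> //=; rewrite !tnthS tnth_mktuple.
Qed.

(** By induction on [m]: the first coordinate is the outermost variable of one of
the two groups. If it belongs to the second group, it has to be moved inside the
integral over the first group, by Tonelli. *)
Lemma ge0_integral_merge m n p q (f : n.-tuple R -> \bar R) :
  size m = n -> count id m = p -> count negb m = q ->
  measurable_fun setT f -> (forall x, 0 <= f x)%E ->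
  (\int[lebesgue_tuple R n]_x f x =
   \int[lebesgue_tuple R p]_y \int[lebesgue_tuple R q]_z f (merge n m y z))%E.
Proof.
elim: m n p q f => [|b m IH] [|n] p q f //= => [_ <- <- mf f0|].
  rewrite !ge0_integral_tuple0//.
  + by congr f; apply: eq_from_tnth; case.
  + apply: measurableT_comp mf _.
    exact: (measurableT_comp (measurable_merge 0 [::] 0 0) (pair1_measurable _)).
  + apply: (measurable_fun_fubini_tonelli_F (m2 := lebesgue_tuple R 0)
      (fun p => f (merge 0 [::] p.1 p.2))) => //.
    exact: measurableT_comp mf (measurable_merge 0 [::] 0 0).
case=> mn; have mc (s : R) := measurable_cons_pairl n s.
have mm p' q' m' :=  measurable_merge n.+1 m' p' q'.
case: b => /=; rewrite ?add0n ?add1n => mp mq mf f0.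
- rewrite ge0_integral_cons//.
  case: p mp => // p [mp].
  rewrite [RHS]ge0_integral_cons; last 2 first.
  + apply: (measurable_fun_fubini_tonelli_F (m2 := lebesgue_tuple R q)
      (fun p => f (merge n.+1 (true :: m) p.1 p.2))) => //.
    exact: measurableT_comp mf (mm _ _ _).
  + by move=> y; apply: integral_ge0.
  apply: eq_integral => s _.
  rewrite (IH n p q _ mn mp mq (measurableT_comp mf (mc s)) (fun t => f0 _)).
  apply: eq_integral => y _; apply: eq_integral => z _.
  by rewrite merge_consl.
- rewrite ge0_integral_cons_swap//.
  case: q mq => // q [mq].
  transitivity (\int[lebesgue_tuple R p]_y  \int[lebesgue_tuple R q]_z
     \int[lebesgue_measure]_s f (cons_pair (s, merge n m y z)))%E.
    rewrite (IH _ p q)//; last by move=> y; apply: integral_ge0.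
    apply: (measurable_fun_fubini_tonelli_G (m1 := lebesgue_measure)
      (fun p : measurableTypeR R * n.-tuple R => f (cons_pair p))) => //.
    exact: measurableT_comp mf (@measurable_cons_pair R n).
  apply: eq_integral => y _.
  have mfy : measurable_fun setT (fun z : q.+1.-tuple R => f (merge n.+1 (false :: m) y z)).
    exact: (measurableT_comp mf (measurableT_comp (mm _ _ _) (pair1_measurable _))).
  rewrite (ge0_integral_cons_swap _ _ _ mfy (fun z => f0 _)).
  apply: eq_integral => z _; apply: eq_integral => s _.
  by rewrite merge_consr.
Qed.

End merge.

Section splice.
Context {R : realType} {n : nat}.
Implicit Types a : {set 'I_n}.

Lemma index_filter (T : eqType) (P : pred T) (s : seq T) x : P x ->
  index x [seq t <- s | P t] = count P (take (index x s) s).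
Proof.
move=> Px; elim: s => //= h s IH; case: (eqVneq h x) => [->|hx].
  by rewrite Px/= eqxx.
by case: ifPn => /= Ph; rewrite ?(negbTE hx) ?(negbTE Ph) ?Ph IH.
Qed.

Lemma enum_set_filter a : enum a = [seq j <- enum 'I_n | j \in a].
Proof. by rewrite enumT; apply: eq_filter. Qed.

Let mask a := [seq i \in a | i <- enum 'I_n].

Lemma splice_merge a (y : #|a|.-tuple R) (z : #|~: a|.-tuple R) :
  splice y z = merge n (mask a) y z.
Proof.
apply: eq_from_tnth => i; rewrite !tnth_mktuple.
rewrite (nth_map i) ?size_enum_ord// nth_ord_enum.
have E (b : {set 'I_n}) : i \in b ->
    index i (enum b) = count (mem b) (take i (enum 'I_n)).
  by move=> ib; rewrite enum_set_filter index_filter// index_enum_ord.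
rewrite -!(map_take i (fun j : 'I_n => j \in a)) !(count_map (fun j : 'I_n => j \in a)).
case: ifPn => ia; first by rewrite E.
rewrite E ?inE//; congr nth.
by apply: eq_count => j; rewrite !inE.
Qed.

Lemma measurable_splice a : measurable_fun setT
  (fun yz : #|a|.-tuple R * #|~: a|.-tuple R => splice yz.1 yz.2).
Proof.
under eq_fun do rewrite splice_merge.
exact: measurable_merge.
Qed.

Lemma ge0_integral_splice a (f : n.-tuple R -> \bar R) :
  measurable_fun setT f -> (forall x, 0 <= f x)%E ->
  (\int[lebesgue_tuple R n]_x f x =
   \int[lebesgue_tuple R #|a|]_y \int[lebesgue_tuple R #|~: a|]_z
     f (splice y z))%E.
Proof.
move=> mf f0.
have sm : size (mask a) = n by rewrite size_map size_enum_ord.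
have cp : count id (mask a) = #|a|.
  by rewrite count_map cardE enum_set_filter size_filter.
have cq : count negb (mask a) = #|~: a|.
  rewrite count_map cardE enum_set_filter size_filter.
  by apply: eq_count => j; rewrite !inE.
rewrite (ge0_integral_merge (mask a) n #|a| #|~: a| f sm cp cq mf f0).
under eq_integral do under eq_integral do rewrite -splice_merge.
by [].
Qed.

End splice.

Lemma integral_indicT d (T : measurableType d) (R : realType)
    (m : {measure set T -> \bar R}) (A : set T) : measurable A ->
  (\int[m]_x (\1_A x)%:E = m A)%E.
Proof. by move=> mA; rewrite integral_indic// setIT. Qed.

(** * Null sets and slices *)

Section null.
Context d1 d2 (T1 : measurableType d1) (T2 : measurableType d2) (R : realType).
Context (m1 : {sigma_finite_measure set T1 -> \bar R}).
Context (m2 : {sigma_finite_measure set T2 -> \bar R}).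

(** Tonelli for null sets. The measurability of [B] matters for the direction
from right to left, which is used to assemble almost-everywhere statements on
slices into one on the product. *)
Lemma product_measure_eq0 (B : set (T1 * T2)) : measurable B ->
  ((m1 \x m2) B = 0)%E <->
  {ae m1, forall x, {ae m2, forall y, ~ B (x, y)}}.
Proof.
move=> mB; rewrite /product_measure1/=.
have msec x : measurable (xsection B x) by exact: measurable_xsection.
have mf := measurable_fun_xsection m2 mB.
have -> : (\int[m1]_x (m2 \o xsection B) x = \int[m1]_x `|(m2 \o xsection B) x|)%E.
  by apply: eq_integral => x _; rewrite gee0_abs.
have H : (\forall x \ae m1, setT x -> (m2 \o xsection B) x = cst 0%E x) <->
  {ae m1, forall x, {ae m2, forall y, ~ B (x, y)}}.
  split; apply: filterS => x /=.
    move=> /(_ I) B0; exists (xsection B x); split => //.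
    by move=> y /= /notP Bxy; rewrite /xsection/= inE.
  move=> + _; move=> /negligibleS B0; apply/negligibleP => //.
  by apply: B0 => y /=; rewrite /xsection/= inE => Bxy nB; exact: nB.
by rewrite -H; exact: ae_eq_integral_abs.
Qed.

Lemma ae_product (P : T1 * T2 -> Prop) :
  {ae (m1 \x m2)%E, forall p, P p} ->
  {ae m1, forall x, {ae m2, forall y, P (x, y)}}.
Proof.
move=> [N [mN /(product_measure_eq0 _ mN) N0 PN]].
move: N0; apply: filterS => x; apply: filterS => y.
by apply: contra_notP => nP; exact: PN.
Qed.

Lemma ae_product_fst (P : T1 -> Prop) :
  {ae m1, forall x, P x} -> {ae (m1 \x m2)%E, forall p, P p.1}.
Proof.
move=> [N [mN N0 PN]]; exists (N `*` setT); split.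
- exact: measurableX.
- by rewrite product_measure1E//= N0 mul0e.
- by move=> p /= np; split => //; exact: PN.
Qed.

End null.
Arguments product_measure_eq0 {d1 d2 T1 T2 R m1 m2 B}.
Arguments ae_product {d1 d2 T1 T2 R m1 m2 P}.
Arguments ae_product_fst {d1 d2 T1 T2 R m1} m2 {P}.

Section splice_null.
Context {R : realType} {n : nat}.

Lemma measurable_splicer (a : {set 'I_n}) (y : #|a|.-tuple R) :
  measurable_fun setT (fun z : #|~: a|.-tuple R => splice y z).
Proof.
exact: (measurableT_comp (measurable_splice a) (pair1_measurable _)).
Qed.

Lemma lebesgue_splice (a : {set 'I_n}) (A : set (n.-tuple R)) : measurable A ->
  (lebesgue_tuple R n A = (lebesgue_tuple R #|a| \x lebesgue_tuple R #|~: a|)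
    ((fun yz => splice yz.1 yz.2) @^-1` A))%E.
Proof.
move=> mA.
have mS : measurable ((fun yz : #|a|.-tuple R * #|~: a|.-tuple R =>
    splice yz.1 yz.2) @^-1` A).
  by rewrite -[X in measurable X]setTI; exact: measurable_splice.
rewrite -(integral_indicT _ _ _ (lebesgue_tuple R n) _ mA).
rewrite -(integral_indicT _ _ _ (lebesgue_tuple R #|a| \x lebesgue_tuple R #|~: a|)%E _ mS).
rewrite (ge0_integral_splice a)//; last first.
  by apply/measurable_EFinP; exact: measurable_indic.
rewrite fubini_tonelli1//.
by apply/measurable_EFinP; exact: measurable_indic.
Qed.

Lemma ae_splice (a : {set 'I_n}) (P : n.-tuple R -> Prop) :
  {ae lebesgue_tuple R n, forall x, P x} ->
  {ae lebesgue_tuple R #|a|, forall y,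
    {ae lebesgue_tuple R #|~: a|, forall z, P (splice y z)}}.
Proof.
move=> [N [mN N0 PN]].
have := N0; rewrite (lebesgue_splice a)//= => /product_measure_eq0.
move=> /(_ _)/wrap[].
  by rewrite -[X in measurable X]setTI; exact: measurable_splice.
apply: filterS => y; apply: filterS => z /=.
by apply: contra_notP => nP; exact: PN.
Qed.

Lemma splice_null (a : {set 'I_n}) (A : set (n.-tuple R)) : measurable A ->
  {ae lebesgue_tuple R #|a|, forall y,
    {ae lebesgue_tuple R #|~: a|, forall z, ~ A (splice y z)}} ->
  lebesgue_tuple R n A = 0%E.
Proof.
move=> mA H; rewrite (lebesgue_splice a)//; apply/product_measure_eq0 => //.
by rewrite -[X in measurable X]setTI; exact: measurable_splice.
Qed.

End splice_null.

Lemma ae_dilate (R : realType) k (c : R) (P : k.-tuple R -> Prop) : 0 < c ->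
  {ae lebesgue_tuple R k, forall x, P x} ->
  {ae lebesgue_tuple R k, forall x, P (dilate c x)}.
Proof.
move=> c0 [N [mN N0 PN]]; exists (dilate c @^-1` N).
have mD : measurable (@dilate R k c @^-1` N).
  by rewrite -[X in measurable X]setTI; exact: measurable_dilate.
split => //; last by move=> x nP; exact: PN.
have mI : measurable_fun setT (EFin \o \1_N : k.-tuple R -> \bar R).
  by apply/measurable_EFinP; exact: measurable_indic.
have I0 x : (0 <= (EFin \o \1_N : k.-tuple R -> \bar R) x)%E by rewrite lee_fin.
have : (0 = (c ^+ k)%:E * lebesgue_tuple R k (dilate c @^-1` N))%E.
  rewrite -N0 -(integral_indicT _ _ _ _ _ mN) -(integral_indicT _ _ _ _ _ mD).
  exact: ge0_integral_dilate.
move=> /esym/eqP.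
by rewrite mule_eq0 eqe expf_eq0 (gt_eqF c0) andbF/= => /eqP.
Qed.

(** * Norm, ball and reflections *)

Section euclid.
Context {R : realType}.

Lemma enorm_sqr k (x : k.-tuple R) : enorm x ^+ 2 = \sum_(i < k) tnth x i ^+ 2.
Proof. by rewrite sqr_sqrtr// sumr_ge0// => i _; rewrite sqr_ge0. Qed.

Lemma enorm_ge0 k (x : k.-tuple R) : 0 <= enorm x.
Proof. exact: sqrtr_ge0. Qed.

Lemma unit_ballE k (x : k.-tuple R) : unit_ball x = (enorm x ^+ 2 <= 1) :> Prop.
Proof. by rewrite /unit_ball/= expr_le1// enorm_ge0. Qed.

Lemma enorm_dilate k c (x : k.-tuple R) :
  enorm (dilate c x) ^+ 2 = c ^+ 2 * enorm x ^+ 2.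
Proof.
rewrite !enorm_sqr mulr_sumr; apply: eq_bigr => i _.
by rewrite tnth_mktuple exprMn.
Qed.

Lemma enorm_flip k i (x : k.-tuple R) : enorm (flip i x) = enorm x.
Proof.
congr Num.sqrt; apply: eq_bigr => j _; rewrite tnth_mktuple.
by case: ifP => // _; rewrite sqrrN.
Qed.

Lemma sum_index_enum n (a : {set 'I_n}) (y : #|a|.-tuple R) (F : R -> R) :
  \sum_(i in a) F (y`_(index i (enum a))) = \sum_(j < #|a|) F (tnth y j).
Proof.
rewrite big_enum_val; apply: eq_bigr => j _; congr F.
by rewrite (tnth_nth 0) (enum_val_nth (enum_val j)) index_uniq ?enum_uniq -?cardE.
Qed.

Lemma enorm_splice n (a : {set 'I_n}) (y : #|a|.-tuple R) (z : #|~: a|.-tuple R) :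
  enorm (splice y z) ^+ 2 = enorm y ^+ 2 + enorm z ^+ 2.
Proof.
rewrite !enorm_sqr (bigID [in a])/=; congr (_ + _).
  rewrite -(sum_index_enum n a y (fun t => t ^+ 2)).
  by apply: eq_bigr => i ia; rewrite tnth_mktuple ia.
rewrite -(sum_index_enum n (~: a) z (fun t => t ^+ 2)).
apply: eq_big => i; first by rewrite inE.
by move=> /negbTE ia; rewrite tnth_mktuple ia.
Qed.

Lemma enorm_cons k s (t : k.-tuple R) :
  enorm (cons_pair (s, t)) ^+ 2 = s ^+ 2 + enorm t ^+ 2.
Proof.
rewrite !enorm_sqr big_ord_recl; congr (_ + _).
by apply: eq_bigr => i _; rewrite tnthS.
Qed.

Lemma measurable_enorm_sqr k :
  measurable_fun setT (fun x : k.-tuple R => enorm x ^+ 2).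
Proof.
under eq_fun do rewrite enorm_sqr.
apply: measurable_sum => i; apply: measurable_funX; exact: measurable_tnth.
Qed.

Lemma measurable_unit_ball k : measurable (@unit_ball R k).
Proof.
rewrite (_ : unit_ball = (fun x => enorm x ^+ 2) @^-1` `]-oo, 1]).
  by rewrite -[X in measurable X]setTI; exact: measurable_enorm_sqr.
by apply/seteqP; split => x; rewrite /= unit_ballE in_itv/=.
Qed.

(** Reflecting a coordinate outside [a] only affects the second argument of
[splice], where it is again the reflection of a coordinate. *)
Lemma flip_splice n (a : {set 'I_n}) i : i \notin a ->
  exists j, forall (y : #|a|.-tuple R) z, flip i (splice y z) = splice y (flip j z).
Proof.
move=> ia; have iN : (index i (enum (~: a)) < #|~: a|)%N.
  by rewrite cardE index_mem mem_enum inE.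
exists (Ordinal iN) => y z; apply: eq_from_tnth => k; rewrite !tnth_mktuple.
case: ifPn => [/eqP->|ki]; first by rewrite (negbTE ia) -[index i _]/(val (Ordinal iN)) -!tnth_nth tnth_mktuple eqxx.
case: ifPn => // ka.
have kN : (index k (enum (~: a)) < #|~: a|)%N.
  by rewrite cardE index_mem mem_enum inE.
rewrite -[index k _]/(val (Ordinal kN)) -!tnth_nth tnth_mktuple ifN//.
rewrite -val_eqE/=; apply: contra ki => /eqP ki; apply/eqP.
have := @nth_index _ i i (enum (~: a)); rewrite -ki mem_enum inE => /(_ ia) <-.
by rewrite (set_nth_default k) ?nth_index// -?cardE// mem_enum inE.
Qed.

Lemma flip_splice_const n (i : 'I_n) (y : #|~: [set i]|.-tuple R) (s : R) :
  flip i (splice y [tuple s | _ < #|~: ~: [set i]|]) =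
  splice y [tuple - s | _ < #|~: ~: [set i]|].
Proof.
have [|j ->] := @flip_splice n (~: [set i]) i; first by rewrite !inE eqxx.
congr splice; apply: eq_from_tnth => k; rewrite !tnth_mktuple ifT//.
have q1 : #|~: ~: [set i]| = 1%N by rewrite finset.setCK cards1.
by move: j k; rewrite q1 => j k; rewrite !ord1.
Qed.

Lemma measurable_flip n (i : 'I_n) : measurable_fun setT (@flip R n i).
Proof.
apply: measurable_fun_tuple => j; under eq_fun do rewrite tnth_mktuple.
case: (j == i); last exact: measurable_tnth.
by apply: measurableT_comp => //; exact: measurable_tnth.
Qed.

Lemma measurable_const_tuple q :
  measurable_fun setT (fun s : R => [tuple s | _ < q]).
Proof.
apply: measurable_fun_tuple => j; under eq_fun do rewrite tnth_mktuple.
exact: measurable_id.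
Qed.

(** Splitting off the reflected coordinate reduces this to the invariance of
the Lebesgue measure of the line under [-%R]. *)
Lemma ge0_integral_flip n (i : 'I_n) (f : n.-tuple R -> \bar R) :
  measurable_fun setT f -> (forall x, 0 <= f x)%E ->
  (\int[lebesgue_tuple R n]_x f (flip i x) = \int[lebesgue_tuple R n]_x f x)%E.
Proof.
move=> mf f0; have q1 : #|~: ~: [set i]| = 1%N by rewrite finset.setCK cards1.
have mff : measurable_fun setT (f \o flip i).
  exact: measurableT_comp mf (measurable_flip n i).
rewrite (ge0_integral_splice (~: [set i]) f mf f0).
rewrite (ge0_integral_splice (~: [set i]) _ mff (fun x => f0 _)).
apply: eq_integral => y _.
have mfs : measurable_fun setT (fun z => f (splice y z)).
  exact: measurableT_comp mf (measurable_splicer _ _).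
rewrite (ge0_integral_tuple1 _ _ (fun z => f (flip i (splice y z))))//; last first.
  exact: measurableT_comp mff (measurable_splicer _ _).
rewrite (ge0_integral_tuple1 _ _ (fun z => f (splice y z)))//.
rewrite -[RHS]ge0_integral_opp//; last first.
  exact: (measurableT_comp mfs (measurable_const_tuple _)).
by apply: eq_integral => s _; rewrite flip_splice_const.
Qed.

(** The ball is contained in the cube of side 2, whose measure is computed by
induction. *)
Lemma ball_lty k : (lebesgue_tuple R k unit_ball < +oo)%E.
Proof.
pose cube k := [set x : k.-tuple R | forall i, tnth x i \in `[-1, 1]].
have mcube j : measurable (cube j).
  rewrite (_ : cube j = \bigcap_(i in [set: 'I_j]) (@tnth j R ^~ i @^-1` `[-1, 1])).
    apply: fin_bigcap_measurable => // i _.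
    by rewrite -[X in measurable X]setTI; exact: measurable_tnth.
  by apply/seteqP; split => x /= xc; [move=> i _; exact: xc|move=> i; exact: xc].
apply: (@le_lt_trans _ _ (lebesgue_tuple R k (cube k))).
  apply: le_measure; rewrite ?inE; [exact: measurable_unit_ball|exact: mcube|].
  move=> x ux i; have : unit_ball x by [].
  rewrite unit_ballE enorm_sqr => x1.
  rewrite in_itv/= -ler_norml -(@expr_le1 _ 2)// real_normK ?num_real//.
  apply: le_trans x1; rewrite (bigD1 i)//= lerDl.
  by rewrite sumr_ge0// => j _; rewrite sqr_ge0.
elim: k => [|k IH]; first by rewrite /= diracE ltry.
rewrite /= /lebesgue_cons /pushforward.
rewrite (_ : _ @^-1` _ = `[-1, 1]%classic `*` cube k); last first.
  apply/seteqP; split => -[s t] /=.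
    move=> st; split; first by have := st ord0.
    by move=> i; have := st (lift ord0 i); rewrite tnthS.
  move=> [sI tc] i; case: (unliftP ord0 i) => [j|] -> //.
  by rewrite tnthS; exact: tc.
rewrite product_measure1E; [|exact: measurable_itv|exact: mcube].
apply: lte_mul_pinfty; rewrite ?ge0_fin_numE//.
  by rewrite /= lebesgue_measure_itv/=; case: ifP => _; rewrite ?ltry.
Qed.

Lemma sqr_null (c : R) : (@lebesgue_measure R) [set s | s ^+ 2 = c] = 0%E.
Proof.
apply: countable_lebesgue_measure0; apply: finite_set_countable.
apply: (@sub_finite_set _ _ [set Num.sqrt c; - Num.sqrt c]).
  move=> s /= <-; rewrite sqrtr_sqr.
  by case: (ger0P s) => _; [left|right; rewrite opprK].
by rewrite finite_setU; split; exact: finite_set1.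
Qed.

(** Once the last coordinates are fixed, the first one can take at most two
values. *)
Lemma sphere_null k : lebesgue_tuple R k [set x | enorm x ^+ 2 = 1] = 0%E.
Proof.
have mS : measurable [set x : k.-tuple R | enorm x ^+ 2 = 1].
  rewrite (_ : mkset _ = (fun x => enorm x ^+ 2) @^-1` [set 1])//.
  by rewrite -[X in measurable X]setTI; exact: measurable_enorm_sqr.
case: k mS => [|k] mS.
  rewrite /= /dirac/= indicE memNset//=.
  by rewrite enorm_sqr big_ord0 => /esym/eqP; rewrite oner_eq0.
rewrite -(integral_indicT _ _ _ _ _ mS) ge0_integral_cons_swap//; last first.
  by apply/measurable_EFinP; exact: measurable_indic.
rewrite integral0_eq// => t _.
rewrite -[RHS](sqr_null (1 - enorm t ^+ 2)).
have mQ : measurable [set s : measurableTypeR R | s ^+ 2 = 1 - enorm t ^+ 2].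
  rewrite (_ : mkset _ = (fun s => s ^+ 2) @^-1` [set 1 - enorm t ^+ 2])//.
  by rewrite -[X in measurable X]setTI; exact: exprn_measurable.
rewrite -(integral_indicT _ _ _ _ _ mQ); apply: eq_integral => s _.
rewrite !indicE; congr (nat_of_bool _)%:R%:E; apply/idP/idP; rewrite !inE/= enorm_cons.
  by move=> /eqP; rewrite eq_sym -subr_eq => /eqP.
by move=> ->; rewrite subrK.
Qed.

End euclid.

(** * The Abel kernel *)

(** Since [Num.sqrt] vanishes on negative numbers and [0^-1 = 0], this is
[v^(-1/2)] extended by 0 to [v <= 0], which spares indicator functions. *)
Definition invsqrt {R : realType} (v : R) : R := (Num.sqrt v)^-1.

Lemma measurable_invsqrt (R : realType) : measurable_fun [set: R] (@invsqrt R).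
Proof.
rewrite (_ : invsqrt = fun v : R => powR (Num.sqrt v) (-1)).
  apply: (measurableT_comp (measurable_powR (-1))).
  by apply: continuous_measurable_fun; exact: sqrt_continuous.
by apply/funext => v; rewrite powR_inv1 ?sqrtr_ge0.
Qed.

Section abel.
Context {R : realType} (b c : R).
Context (b0 : 0 <= b) (bc : b < c).

(** The increasing affine function of [r^2] that maps [b] to -1 and [c] to 1; an
antiderivative of [f] on [dom] is [asin (w r) / 2]. *)
Let w (r : R) : R := (2 * r ^+ 2 - b - c) / (c - b).
Let f (r : R) : R := r * invsqrt (r ^+ 2 - b) * invsqrt (c - r ^+ 2).
Let dom := [set r : R | 0 < r /\ b < r ^+ 2 < c].

Let f_ge0 r : 0 <= r -> 0 <= f r.
Proof. by move=> r0; rewrite /f !mulr_ge0// invr_ge0 sqrtr_ge0. Qed.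

Let f_continuous r : dom r -> {for r, continuous f}.
Proof.
move=> [r0 /andP[br rc]].
have cs (g : R -> R) : {for r, continuous g} -> 0 < g r ->
    {for r, continuous (fun t => invsqrt (g t))}.
  move=> cg gr; apply: cvgV; first by rewrite sqrtr_eq0 -ltNge.
  by apply: continuous_comp cg _; exact: sqrt_continuous.
have c2 : {for r, continuous (fun t : R => t ^+ 2)} by exact: exprn_continuous.
apply: continuousM; first apply: continuousM => //.
- apply: cs; last by rewrite subr_gt0.
  by apply: continuousB => //; exact: cst_continuous.
- apply: cs; last by rewrite subr_gt0.
  by apply: continuousB => //; exact: cst_continuous.
Qed.

Let w_bnd r : dom r -> -1 < w r < 1.
Proof.
move=> [r0 /andP[br rc]]; rewrite /w ltr_pdivlMr ?ltr_pdivrMr ?subr_gt0//.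
by apply/andP; split; lra.
Qed.

Let asin_w_derive r : dom r -> is_derive r 1 (fun t => asin (w t) / 2) (f r).
Proof.
move=> dr; have := w_bnd r dr => wr.
have [r0 /andP[br rc]] := dr.
have dw : is_derive r 1 w (4 * r / (c - b)).
  rewrite /w; apply: is_derive_eq.
  by rewrite /GRing.scale/=; ring.
have da := is_derive1_asin wr.
have dc : is_derive r 1 (fun t => asin (w t)) ((Num.sqrt (1 - w r ^+ 2))^-1 * (4 * r / (c - b))).
  exact: is_derive1_comp.
apply: is_derive_eq.
rewrite /GRing.scale/= /f /invsqrt.
have cb0 : c - b != 0 by rewrite gt_eqF// subr_gt0.
have -> : 1 - w r ^+ 2 = (2 / (c - b)) ^+ 2 * ((r ^+ 2 - b) * (c - r ^+ 2)).
  by rewrite /w; field.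
have rb0 : 0 < r ^+ 2 - b by rewrite subr_gt0.
have cr0 : 0 < c - r ^+ 2 by rewrite subr_gt0.
rewrite sqrtrM ?sqr_ge0// sqrtr_sqr gtr0_norm ?divr_gt0 ?subr_gt0//.
rewrite sqrtrM ?ltW//.
have s1 : Num.sqrt (r ^+ 2 - b) != 0 by rewrite sqrtr_eq0 -ltNge.
have s2 : Num.sqrt (c - r ^+ 2) != 0 by rewrite sqrtr_eq0 -ltNge.
by field; rewrite s1 s2 cb0.
Qed.

(** [dom] is exhausted by the segments [I n] on which [|asin (w r)| <= th n], where
[th n] increases to pi/2; [rad] is the inverse of [w] on nonnegative numbers.
The fundamental theorem of calculus applies on each of them, but not on [dom],
at whose ends [f] is not continuous. *)
Let th n : R := pi / 2 * (1 - n.+2%:R^-1).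
Let rad (v : R) : R := Num.sqrt ((b + c + (c - b) * v) / 2).
Let I n : set (measurableTypeR R) :=
  `[rad (- sin (th n)), rad (sin (th n))]%classic.

Let rad_dom v : -1 < v < 1 -> dom (rad v).
Proof.
move=> /andP[v1 v2]; have cb0 : 0 < c - b by rewrite subr_gt0.
have cbv : -1 * (c - b) < (c - b) * v < 1 * (c - b).
  by rewrite [_ * v]mulrC !ltr_pM2r// v1.
have rv0 : b < (b + c + (c - b) * v) / 2 < c by lra.
have rv1 : 0 < (b + c + (c - b) * v) / 2.
  by case/andP: rv0 => + _; exact: le_lt_trans.
by split; [rewrite sqrtr_gt0|rewrite /rad sqr_sqrtr// ltW].
Qed.

Let w_le v r : 0 <= r -> (v <= w r) = ((b + c + (c - b) * v) / 2 <= r ^+ 2).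
Proof.
move=> r0; rewrite /w ler_pdivlMr ?subr_gt0// ler_pdivrMr// [(c - b) * v]mulrC.
by apply/idP/idP; lra.
Qed.

Let w_ge v r : 0 <= r -> (w r <= v) = (r ^+ 2 <= (b + c + (c - b) * v) / 2).
Proof.
move=> r0; rewrite /w ler_pdivrMr ?subr_gt0// ler_pdivlMr// [(c - b) * v]mulrC.
by apply/idP/idP; lra.
Qed.

Let radK v : -1 < v < 1 -> w (rad v) = v.
Proof.
move=> /rad_dom[r0 _]; have r0' := ltW r0; move: r0; rewrite sqrtr_gt0 => rv.
apply/eqP; rewrite eq_le w_le// w_ge//.
by rewrite sqr_sqrtr ?lexx// ltW.
Qed.

Let I_itv v r : -1 < v < 1 -> 0 <= r ->
  (rad v <= r) = (v <= w r) /\ (r <= rad v) = (w r <= v).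
Proof.
move=> v1 r0; rewrite w_le// w_ge//.
have [rv _] := rad_dom v v1.
have r2 : rad v ^+ 2 = (b + c + (c - b) * v) / 2.
  by rewrite /rad sqr_sqrtr//; move: rv; rewrite /rad sqrtr_gt0 => /ltW.
by rewrite -r2; split; rewrite ler_pXn2r// nnegrE// ltW.
Qed.

Let pihalf_gt0 : 0 < pi / 2 :> R.
Proof. by rewrite divr_gt0// pi_gt0. Qed.

Let th_gt0 n : 0 < th n.
Proof.
apply: mulr_gt0; first exact: pihalf_gt0.
by rewrite subr_gt0 invf_lt1 ?ltr0n// ltr1n.
Qed.

Let th_lt n : th n < pi / 2.
Proof.
by rewrite -[ltRHS]mulr1 ltr_pM2l ?pihalf_gt0// gtrBl invr_gt0 ltr0n.
Qed.

Let th_itv n : th n \in `[- (pi / 2), pi / 2] /\ - th n \in `[- (pi / 2), pi / 2].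
Proof.
have := th_gt0 n; have := th_lt n; rewrite !in_itv/=.
by move=> *; split; apply/andP; split; lra.
Qed.

Let sin_th n : 0 < sin (th n) < 1.
Proof.
rewrite sin_gt0_pihalf ?th_gt0 ?th_lt//=.
have := @ltr_sin R (th n) (pi / 2) (th_itv n).1; rewrite sin_pihalf => ->//.
by rewrite in_itv/= lexx andbT; have := pihalf_gt0; lra.
Qed.

Let sin_th1 n : -1 < sin (th n) < 1 /\ -1 < - sin (th n) < 1.
Proof. by have := sin_th n; split; lra. Qed.

Let I_dom n r : I n r <-> 0 < r /\ - sin (th n) <= w r <= sin (th n).
Proof.
have [s1 s2] := sin_th1 n.
have [rp _] := rad_dom _ s2.
rewrite /I/= in_itv/=; split.
  move=> /andP[r1 r2]; have r0 := lt_le_trans rp r1; split => //.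
  have r0' := ltW r0.
  by rewrite -(I_itv _ _ s1 r0').2 -(I_itv _ _ s2 r0').1 r1.
move=> [/ltW r0].
by rewrite -(I_itv _ _ s1 r0).2 -(I_itv _ _ s2 r0).1.
Qed.

Let I_sub n r : I n r -> dom r.
Proof.
move=> /I_dom[r0]; have [s1 s2] := sin_th1 n => /andP[w1 w2]; split => //.
have : -1 < w r < 1 by lra.
by rewrite /w ltr_pdivlMr ?ltr_pdivrMr ?subr_gt0// => /andP[? ?]; apply/andP; split; lra.
Qed.

Let integral_I n : (\int[lebesgue_measure]_(r in I n) (f r)%:E = (th n)%:E)%E.
Proof.
have [s1 s2] := sin_th1 n; have s0 := sin_th n.
have d1 := rad_dom _ s1; have d2 := rad_dom _ s2.
have r12 : rad (- sin (th n)) < rad (sin (th n)).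
  rewrite ltNge (I_itv _ _ s2 (ltW d1.1)).2 radK// -ltNge; lra.
pose F t := asin (w t) / 2.
have cF r : dom r -> {for r, continuous F}.
  move=> dr; apply/differentiable_continuous/derivable1_diffP.
  by have [] := asin_w_derive r dr.
rewrite /I (@continuous_FTC2 _ f F)//.
- rewrite /F !radK// -sinN !sinK ?(th_itv n)//; last 2 first.
  + exact: (th_itv n).2.
  + exact: (th_itv n).1.
  by rewrite -EFinB; congr EFin; field.
- apply: continuous_in_subspaceT => r; rewrite inE => Ir.
  by apply: f_continuous; exact: (I_sub n).
- split.
  + move=> r /subset_itv_oo_cc Ir.
    by have [] := asin_w_derive r (I_sub n r Ir).
  + by apply: cvg_at_right_filter; exact: cF.
  + by apply: cvg_at_left_filter; exact: cF.
- move=> r /subset_itv_oo_cc Ir.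
  rewrite derive1E; apply: derive_val.
  exact: asin_w_derive (I_sub n r Ir).
Qed.

(** The value depends neither on [b] nor on [c]: this is what makes the Abel
transform invertible. *)
Lemma abel_kernel_integral : (\int[lebesgue_measure]_(r in dom) (f r)%:E = (pi / 2)%:E)%E.
Proof.
have domE : dom = \bigcup_n I n.
  apply/seteqP; split => r; last by move=> [n _]; exact: I_sub.
  move=> dr; have wr := w_bnd r dr.
  have wr1 : -1 <= w r <= 1 by lra.
  have aw1 : asin (w r) < pi / 2 by apply: asin_ltpi2; lra.
  have aw2 : - (pi / 2) < asin (w r) by apply: asin_gtNpi2; lra.
  pose m : R := Order.max (asin (w r)) (- asin (w r)).
  have m1 : m < pi / 2 by rewrite gt_max aw1 /=; lra.
  have p0 := pihalf_gt0.
  (* some n with 1/(n+2) below the relative gap between m and pi/2 *)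
  pose e := 1 - m / (pi / 2).
  have e0 : 0 < e by rewrite subr_gt0 ltr_pdivrMr// mul1r.
  have [n _ ne] := near_infty_natSinv_lt (PosNum e0).
  have mth : m <= th n.
    rewrite /th -ler_pdivrMl// mulrC lerBrDr -lerBrDl.
    apply: ltW; apply: (ne n.+1).
    exact: leqnSn.
  exists n => //; apply/I_dom; split; first exact: dr.1.
  have mm : (asin (w r) <= m) && (- asin (w r) <= m) by rewrite !le_max !lexx orbT.
  have thw : - th n <= asin (w r) <= th n by lra.
  have tl := th_lt n; have t0 := th_gt0 n.
  rewrite -(asinK (x := w r)) ?in_itv//=.
  rewrite -sinN !leNgt !ltr_sin ?(th_itv n).1 ?(th_itv n).2//.
  - by rewrite -!leNgt.
  - by rewrite in_itv/=; lra.
  - by rewrite in_itv/=; lra.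
rewrite domE.
have mI i : measurable (I i) by exact: measurable_itv.
have mf i : measurable_fun (I i) (fun r => (f r)%:E).
  apply: measurable_funTS; apply/measurable_EFinP.
  have m2 : measurable_fun setT (fun r : R => r ^+ 2) by exact: exprn_measurable.
  apply: measurable_funM; first apply: measurable_funM => //.
    apply: (measurableT_comp (measurable_invsqrt R)).
    exact: measurable_funB.
  apply: (measurableT_comp (measurable_invsqrt R)).
  exact: measurable_funB.
have ndI : nondecreasing_seq I.
  move=> i j ij; apply/subsetPset => r /I_dom[r0 wr]; apply/I_dom; split => //.
  suff : sin (th i) <= sin (th j) by lra.
  rewrite leNgt ltr_sin ?(th_itv i).1 ?(th_itv j).1// -leNgt.
  rewrite ler_pM2l// lerD2l lerN2 lef_pV2 ?posrE ?ltr0n// ler_nat.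
  by rewrite !ltnS.
have f0 i r : I i r -> (0 <= (f r)%:E)%E.
  by move=> /I_dom[r0 _]; rewrite lee_fin f_ge0// ltW.
have IU := ge0_nondecreasing_set_cvg_integral (mu := lebesgue_measure) ndI mI mf f0.
have H : (\int[lebesgue_measure]_(r in I n) (f r)%:E)%E @[n --> \oo] --> (pi / 2)%:E; last first.
  by rewrite -(cvg_lim _ IU)// (cvg_lim _ H).
under eq_fun do rewrite integral_I.
apply: cvg_EFin; first exact: nearW.
rewrite -[X in _ --> X]mulr1; apply: cvgM; first exact: cvg_cst.
rewrite -[X in _ --> X]subr0; apply: cvgB; first exact: cvg_cst.
have : (fun k => k.+1%:R^-1 : R) @ \oo --> (0 : R).
  exact: cvg_harmonic.
by rewrite -cvg_shiftS.
Qed.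

End abel.

(** For [b = 0] this is the indicator of [r > 0]; the same integral thus also
bounds the mass of the kernel [(c - r^2)^(-1/2)]. *)
Definition abel_weight {R : realType} (b r : R) : R :=
  if 0 < r then r * invsqrt (r ^+ 2 - b) else 0.

Section abel.
Context {R : realType}.
Implicit Types b c r : R.

Lemma invsqrt_ge0 r : 0 <= invsqrt r.
Proof. by rewrite invr_ge0 sqrtr_ge0. Qed.

Lemma invsqrt_le0 r : r <= 0 -> invsqrt r = 0.
Proof. by move=> r0; rewrite /invsqrt ler0_sqrtr// invr0. Qed.

Lemma invsqrt_scale r v : 0 < r -> r * invsqrt (r ^+ 2 * v) = invsqrt v.
Proof.
move=> r0; rewrite /invsqrt sqrtrM ?sqr_ge0// sqrtr_sqr gtr0_norm// invfM.
by rewrite mulrA mulfV ?mul1r// gt_eqF.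
Qed.

Lemma abel_weight_ge0 b r : 0 <= abel_weight b r.
Proof.
by rewrite /abel_weight; case: ifP => // /ltW r0; rewrite mulr_ge0 ?invsqrt_ge0.
Qed.

Lemma abel_weight0 r : 0 < r -> abel_weight 0 r = 1.
Proof.
move=> r0; rewrite /abel_weight r0 subr0 /invsqrt sqrtr_sqr gtr0_norm//.
by rewrite mulfV// gt_eqF.
Qed.

Lemma measurable_abel_weight b : measurable_fun [set: R] (abel_weight b).
Proof.
apply: measurable_fun_if => //.
  exact: measurable_fun_ltr.
apply: measurable_funTS; apply: measurable_funM => //.
apply: (measurableT_comp (measurable_invsqrt R)).
by apply: measurable_funB => //; exact: exprn_measurable.
Qed.

Lemma integral_abel b c : 0 <= b ->
  (\int[lebesgue_measure]_r (abel_weight b r * invsqrt (c - r ^+ 2))%:E =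
   (if b < c then pi / 2 else 0)%:E)%E.
Proof.
move=> b0; case: ltP => bc.
  rewrite -(abel_kernel_integral b c b0 bc) [RHS]integral_mkcond.
  apply: eq_integral => r _; rewrite patchE /abel_weight.
  case: (boolP (r \in _)) => [|/negP]; rewrite inE/= => rd.
    by rewrite rd.1.
  case: ifPn => r0; last by rewrite mul0r.
  have [rb|br] := leP (r ^+ 2) b.
    by rewrite (invsqrt_le0 (_ - b)) ?subr_le0// mulr0 mul0r.
  rewrite (invsqrt_le0 (c - _)) ?mulr0// subr_le0 leNgt.
  by apply/negP => rc; apply: rd; rewrite br.
rewrite integral0_eq// => r _; rewrite /abel_weight.
case: ifPn => r0; last by rewrite mul0r.
have [rb|br] := leP (r ^+ 2) b.
  by rewrite (invsqrt_le0 (_ - b)) ?subr_le0// mulr0 mul0r.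
by rewrite (invsqrt_le0 (c - _)) ?mulr0// subr_le0 (le_trans bc)// ltW.
Qed.

End abel.

(** * Signed integrals and antisymmetry *)

(** No finiteness is assumed: [+oo - +oo] is [-oo], which is fixed by
multiplication by [k]. *)
Lemma gt0_muleB (R : realType) (k : R) (x y : \bar R) :
  0 < k -> (0 <= x)%E -> (0 <= y)%E ->
  (k%:E * (x - y) = k%:E * x - k%:E * y)%E.
Proof.
move=> k0; case: x => [a| |]; case: y => [b| |] // _ _.
- exact: (congr1 EFin (mulrBr k a b)).
- by rewrite gt0_muley ?lte_fin//= gt0_muleNy ?lte_fin.
- by rewrite gt0_muley ?lte_fin.
- by rewrite gt0_muley ?lte_fin//= gt0_muleNy ?lte_fin.
Qed.

(** A change of variables for nonnegative functions holds for all measurable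
functions, integrable or not, since it applies to the positive and negative
parts. *)
Lemma integral_transfer d1 d2 (T1 : measurableType d1) (T2 : measurableType d2)
    (R : realType) (mu : {measure set T1 -> \bar R})
    (nu : {measure set T2 -> \bar R}) (phi : T1 -> T2) (k : R) : 0 < k ->
  (forall f : T2 -> \bar R, measurable_fun setT f -> (forall x, 0 <= f x)%E ->
    (\int[nu]_x f x = k%:E * \int[mu]_x f (phi x))%E) ->
  forall f : T2 -> \bar R, measurable_fun setT f ->
    (\int[nu]_x f x = k%:E * \int[mu]_x f (phi x))%E.
Proof.
move=> k0 H f mf; rewrite integralE [in RHS]integralE.
rewrite (H (f^\+)%E)//; last exact: measurable_funepos.
rewrite (H (f^\-)%E)//; last exact: measurable_funeneg.
have : (0 <= \int[mu]_x ((f \o phi)^\+)%E x)%E by exact: integral_ge0.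
have : (0 <= \int[mu]_x ((f \o phi)^\-)%E x)%E by exact: integral_ge0.
have -> : (\int[mu]_x ((f \o phi)^\+)%E x = \int[mu]_x (f^\+)%E (phi x))%E.
  by apply: eq_integral => x _; rewrite funepos_comp.
have -> : (\int[mu]_x ((f \o phi)^\-)%E x = \int[mu]_x (f^\-)%E (phi x))%E.
  by apply: eq_integral => x _; rewrite funeneg_comp.
by move=> ? ?; apply/esym/gt0_muleB.
Qed.

Section signed.
Context {R : realType}.

Lemma integral_opp (f : R -> \bar R) : measurable_fun setT f ->
  (\int[lebesgue_measure]_s f s = \int[lebesgue_measure]_s f (- s)%R)%E.
Proof.
move=> mf; rewrite -[RHS]mul1e; apply: (integral_transfer _ _ (measurableTypeR R) (measurableTypeR R) _ lebesgue_measure lebesgue_measure -%R _ ltr01) mf.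
by move=> h mh h0; rewrite mul1e ge0_integral_opp.
Qed.

Lemma integral_scale (c : R) (f : R -> \bar R) : 0 < c -> measurable_fun setT f ->
  (\int[lebesgue_measure]_s f s = c%:E * \int[lebesgue_measure]_s f (c * s)%R)%E.
Proof.
move=> c0 mf; apply: (integral_transfer _ _ (measurableTypeR R) (measurableTypeR R) _ lebesgue_measure lebesgue_measure ( *%R c) _ c0) mf.
by move=> h mh h0; exact: ge0_integral_scale.
Qed.

Lemma integral_flip n (i : 'I_n) (f : n.-tuple R -> \bar R) :
  measurable_fun setT f ->
  (\int[lebesgue_tuple R n]_x f x = \int[lebesgue_tuple R n]_x f (flip i x))%E.
Proof.
move=> mf; rewrite -[RHS]mul1e; apply: (integral_transfer _ _ _ _ _ (lebesgue_tuple R n) (lebesgue_tuple R n) (flip i) _ ltr01) mf.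
by move=> h mh h0; rewrite mul1e ge0_integral_flip.
Qed.

Lemma integral_tuple1 (q : nat) (f : q.-tuple R -> \bar R) :
  q = 1%N -> measurable_fun setT f ->
  (\int[lebesgue_tuple R q]_x f x =
   \int[lebesgue_measure]_s f [tuple s | _ < q])%E.
Proof.
move=> q1 mf; rewrite -[RHS]mul1e; apply: (integral_transfer _ _ (measurableTypeR R) _ _ lebesgue_measure (lebesgue_tuple R q) (fun s => [tuple s | _ < q]) _ ltr01) mf.
by move=> h mh h0; rewrite mul1e ge0_integral_tuple1.
Qed.

Lemma integral_antisym n (i : 'I_n) (f : n.-tuple R -> R) :
  (lebesgue_tuple R n).-integrable setT (EFin \o f) ->
  {ae lebesgue_tuple R n, forall x, f x = - f (flip i x)} ->
  (\int[lebesgue_tuple R n]_x (f x)%:E = 0)%E.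
Proof.
move=> intf fN; have mf := measurable_int _ intf.
have mff : measurable_fun setT (fun x => (f (flip i x))%:E).
  exact: (measurableT_comp mf (measurable_flip n i)).
have E : (\int[lebesgue_tuple R n]_x (f x)%:E =
    \int[lebesgue_tuple R n]_x - (f x)%:E)%E.
  rewrite [LHS](integral_flip n i (EFin \o f) mf)/=.
  apply: ae_eq_integral => //.
    exact: (measurableT_comp (@oppe_measurable R setT) mf).
  by move: fN; apply: filterS => x -> _ /=; rewrite opprK.
have fin : (\int[lebesgue_tuple R n]_x (f x)%:E)%E \is a fin_num.
  exact: integrable_fin_num intf.
move: E; rewrite integralN; last exact: integrable_add_def.
move: fin; case: (\int[lebesgue_tuple R n]_x (f x)%:E)%E => // r _ [] /eqP.
by rewrite -addr_eq0 -mulr2n mulrn_eq0/= => /eqP ->.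
Qed.

Lemma ae_tuple1 (q : nat) (A : set (q.-tuple R)) : q = 1%N -> measurable A ->
  {ae lebesgue_measure, forall s : R, ~ A [tuple s | _ < q]} ->
  {ae lebesgue_tuple R q, forall x, ~ A x}.
Proof.
move=> q1 mA As; exists A; split => //; last by move=> x /= /notP.
have mB : measurable ((fun s : measurableTypeR R => [tuple s | _ < q]) @^-1` A).
  by rewrite -[X in measurable X]setTI; exact: measurable_const_tuple.
rewrite -(integral_indicT _ _ _ _ _ mA) ge0_integral_tuple1//; last first.
  by apply/measurable_EFinP; exact: measurable_indic.
rewrite [LHS](integral_indicT _ _ _ _ _ mB); apply/negligibleP => //.
by apply: negligibleS As => s /= As nAs; exact: nAs.
Qed.

(** Almost everywhere, the derivative of the primitive is the function. *)
Lemma ae_eq0_of_primitive (f : R -> R) :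
  lebesgue_measure.-integrable setT (EFin \o f) ->
  (forall x, \int[lebesgue_measure]_(t in `]-oo, x]) (f t)%:E = 0)%E ->
  {ae lebesgue_measure, forall x, f x = 0}.
Proof.
move=> intf f0.
have lf : locally_integrable [set: R] f.
  by have := integrable_locally measurableT intf; rewrite patch_setT.
have intfy y : lebesgue_measure.-integrable `]-oo, y] (EFin \o f).
  exact: integrableS intf.
have := FTC1Ny intfy lf.
rewrite (_ : (fun x : R => _) = cst 0); last first.
  by apply/funext => x; rewrite /Rintegral f0.
apply: filterS; first exact: (ae_filter_ringOfSetsType lebesgue_measure).
by move=> x [_ <-]; rewrite derive1_cst.
Qed.

End signed.

(** * Inverting the Abel transform on the line *)

Lemma integrable_weight d (T : measurableType d) (R : realType)
    (mu : {measure set T -> \bar R}) (w f : T -> R) :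
  measurable_fun setT w -> (forall x, `|w x| <= 1) ->
  mu.-integrable setT (EFin \o f) ->
  mu.-integrable setT (fun x => (w x * f x)%:E).
Proof.
move=> mw w1 intf.
have /measurable_EFinP mf := measurable_int _ intf.
apply: le_integrable intf => //.
  by apply/measurable_EFinP; exact: measurable_funM.
by move=> x _ /=; rewrite lee_fin normrM ler_piMl.
Qed.

Lemma integrable_indicM d (T : measurableType d) (R : realType)
    (mu : {measure set T -> \bar R}) (A : set T) (f : T -> R) :
  measurable A -> mu.-integrable setT (EFin \o f) ->
  mu.-integrable setT (fun x => (\1_A x * f x)%:E).
Proof.
move=> mA; apply: integrable_weight; first exact: measurable_indic.
by move=> x; rewrite indicE; case: (_ \in _); rewrite /= ?normr1 ?normr0.
Qed.

Lemma sub_max_min (R : realDomainType) (c t : R) :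
  c - Order.max (c - t) 0 = Order.min t c.
Proof. by case: (leP (c - t) 0) => ct; case: (leP t c) => tc; lra. Qed.

Section one_dim.
Context {R : realType}.
Notation mu := (@lebesgue_measure R).

Lemma ae_neq (a : R) : {ae mu, forall s, s <> a}.
Proof.
exists [set a]; split; [exact: measurable_set1|exact: lebesgue_measure_set1|].
by move=> s /= /notP.
Qed.

Lemma measurable_sqr_lt (t : R) :
  measurable ([set s : R | s ^+ 2 < t] : set (measurableTypeR R)).
Proof.
rewrite (_ : mkset _ = (fun s : measurableTypeR R => s ^+ 2 : measurableTypeR R) @^-1` `]-oo, t[).
  by rewrite -[X in measurable X]setTI; exact: exprn_measurable.
by apply/seteqP; split => s /=; rewrite in_itv.
Qed.

(** On [s > 0] the primitive of [h s + h (- s)] is, up to reflection of the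
negative half, the integral of [h] over a centred segment. *)
Lemma ae_odd (h : R -> R) : mu.-integrable setT (EFin \o h) ->
  (forall t, \int[mu]_s (\1_[set s | s ^+ 2 < t] s * h s)%:E = 0)%E ->
  {ae mu, forall s, h s + h (- s) = 0}.
Proof.
move=> inth h0; have /measurable_EFinP mh := measurable_int _ inth.
have mo : measurable_fun setT (-%R : measurableTypeR R -> measurableTypeR R).
  exact: oppr_measurable.
have mhN : measurable_fun setT (fun s : measurableTypeR R => h (- s)) := measurableT_comp mh mo.
have inthN : mu.-integrable setT (EFin \o (fun s => h (- s))).
  apply/integrableP; split; first exact/measurable_EFinP.
  rewrite (ge0_integral_opp R (fun s => `|(h s)%:E|%E))//; last first.
    by apply: measurableT_comp => //; exact/measurable_EFinP.
  by have /integrableP[_] := inth.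
pose e s := h s + h (- s).
have inte : mu.-integrable setT (EFin \o e).
  have := integrableD measurableT inth inthN.
  exact: eq_integrable.
pose f s := \1_`]0, +oo[ s * e s.
have intf : mu.-integrable setT (EFin \o f).
  by apply: integrable_indicM inte; exact: measurable_itv.
suff f0 : {ae mu, forall s, f s = 0}.
  have fN0 : {ae mu, forall s, f (- s) = 0}.
    have [N [mN N0 fN]] := f0.
    exists (-%R @^-1` N); split.
    - by rewrite -[X in measurable X]setTI; exact: mo.
    - by rewrite -N0; exact: lebesgue_measureN.
    - by move=> s /= fs; exact: fN.
  have n0 := ae_neq 0.
  move: f0 fN0 n0; apply: filterS3; first exact: (ae_filter_ringOfSetsType mu).
  move=> s fs fNs.
  move: fs fNs; rewrite /f /e !indicE !mem_setE !in_itv/= !andbT oppr_gt0 opprK.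
  by case: (ltgtP s 0) => // _; rewrite !mul1r// addrC.
apply: ae_eq0_of_primitive => // x.
rewrite integral_mkcond.
have [x0|x0] := leP x 0.
  rewrite integral0_eq// => s _; rewrite patchE; case: ifPn => //.
  rewrite inE/= in_itv/= => sx; rewrite /f indicE memNset ?mul0r//.
  by rewrite /= in_itv/= andbT => /(lt_le_trans)/(_ (le_trans sx x0)); rewrite ltxx.
(* the two halves of the restriction of h to the segment of radius x *)
pose u s := \1_`]0, x[ s * h s.
pose v s := \1_`](- x), 0[ s * h s.
have intu : mu.-integrable setT (EFin \o u).
  by apply: integrable_indicM inth; exact: measurable_itv.
have intv : mu.-integrable setT (EFin \o v).
  by apply: integrable_indicM inth; exact: measurable_itv.
have mv := measurable_int _ intv.
have mvN : measurable_fun setT (fun s : measurableTypeR R => (v (- s))%:E) := measurableT_comp mv mo.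
have intvN : mu.-integrable setT (EFin \o (fun s => v (- s))).
  rewrite (_ : _ \o _ = fun s => (\1_`](- x), 0[ (- s) * h (- s))%:E)//.
  apply: (integrable_weight _ _ _ _ (fun s : measurableTypeR R => \1_`](- x), 0[ (- s)) (fun s => h (- s))) => //.
    apply: (measurableT_comp _ mo).
    by apply: measurable_indic; exact: measurable_itv.
  by move=> s; rewrite indicE; case: (_ \in _); rewrite /= ?normr1 ?normr0.
transitivity (\int[mu]_s ((u s)%:E + (v (- s))%:E))%E.
  apply: ae_eq_integral => //.
  - have mI : measurable (`]-oo, x]%classic : set (measurableTypeR R)) by [].
    apply: (measurable_restrictT (EFin \o f) mI).1.
    by apply: measurable_funTS; exact: (measurable_int _ intf).
  - exact: (measurable_int _ (integrableD measurableT intu intvN)).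
  - move: (ae_neq x); apply: filterS; first exact: (ae_filter_ringOfSetsType mu).
    move=> s sx _.
    rewrite patchE /u /v /f /e !indicE !mem_setE !in_itv/= !andbT ltrN2 oppr_lt0.
    have [sx'|xs|//] := ltgtP s x.
      by case: ltP => s0; rewrite /= ?mul1r ?mul0r ?adde0// -EFinD.
    by rewrite !andbF !mul0r adde0.
rewrite integralD//.
rewrite -(integral_opp (fun s => (v s)%:E))//.
rewrite -integralD// -[RHS](h0 (x ^+ 2)).
apply: ae_eq_integral => //.
- exact: (measurable_int _ (integrableD measurableT intu intv)).
- by apply: (measurable_int _ (integrable_indicM _ _ _ _ _ _ _ inth)); exact: measurable_sqr_lt.
- move: (ae_neq 0); apply: filterS; first exact: (ae_filter_ringOfSetsType mu).
  move=> s s0 _.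
  rewrite /u /v !indicE.
  have -> : (s \in [set s | s ^+ 2 < x ^+ 2]) = (- x < s < x).
    rewrite mem_setE -ltr_norml -(ltr_pXn2r (n := 2))// ?nnegrE// ?(ltW x0)//.
    by rewrite real_normK// num_real.
  rewrite !mem_setE !in_itv/=.
  have [s0'|s0'|//] := ltgtP s 0.
    by rewrite (lt_trans s0' x0) !andbT /= mul0r add0e.
  by rewrite andbF mul0r adde0 (lt_trans _ s0') ?oppr_lt0.
Qed.

End one_dim.

Section abel_inversion.
Context {R : realType}.
Notation mu := (@lebesgue_measure R).

(** Fubini for [abel_weight b r * invsqrt (c - r^2 - s^2) * h s] on the plane:
integrating in [s] first gives 0, integrating in [r] first gives pi/2 times [h]
restricted to [s^2 < c - b]. *)
Lemma abel_inversion (h : R -> R) (c : R) :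
  mu.-integrable setT (EFin \o h) ->
  {ae mu, forall r, 0 < r ->
    (\int[mu]_s (invsqrt (c - r ^+ 2 - s ^+ 2) * h s)%:E = 0)%E} ->
  forall b, 0 <= b ->
    (\int[mu]_s (\1_[set s | s ^+ 2 < c - b] s * h s)%:E = 0)%E.
Proof.
move=> inth H b b0; have /measurable_EFinP mh := measurable_int _ inth.
have p0 : 0 < pi / 2 :> R by rewrite divr_gt0 ?pi_gt0.
pose K (p : measurableTypeR R * measurableTypeR R) :=
  abel_weight b p.1 * invsqrt (c - p.1 ^+ 2 - p.2 ^+ 2) * h p.2.
have mK : measurable_fun setT K.
  apply: measurable_funM; first apply: measurable_funM.
  - exact: (measurableT_comp (measurable_abel_weight b) measurable_fst).
  - apply: (measurableT_comp (measurable_invsqrt R)).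
    apply: measurable_funB; first apply: measurable_funB => //.
    + exact: (measurableT_comp (exprn_measurable _) measurable_fst).
    + exact: (measurableT_comp (exprn_measurable _) measurable_snd).
  - exact: (measurableT_comp mh measurable_snd).
have mKr s : measurable_fun setT (fun r : measurableTypeR R => K (r, s)).
  exact: (measurableT_comp mK (pair2_measurable _)).
have indicE' s : (if b < c - s ^+ 2 then pi / 2 else 0) =
    pi / 2 * \1_[set s | s ^+ 2 < c - b] s :> R.
  rewrite indicE.
  have -> : (s \in [set s0 | s0 ^+ 2 < c - b]) = (b < c - s ^+ 2).
    by apply/idP/idP; rewrite inE/=; lra.
  by case: ifP; rewrite ?mulr1 ?mulr0.
have ma s : measurable_fun [set: R] (fun r => abel_weight b r * invsqrt (c - s ^+ 2 - r ^+ 2)).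
  apply: measurable_funM; first exact: measurable_abel_weight.
  apply: (measurableT_comp (measurable_invsqrt R)).
  by apply: measurable_funB => //; exact: exprn_measurable.
have KE r s : K (r, s) = h s * (abel_weight b r * invsqrt (c - s ^+ 2 - r ^+ 2)).
  by rewrite /K/= mulrC; congr (_ * (_ * invsqrt _)); lra.
have K_int s : (\int[mu]_r (K (r, s))%:E =
    (pi / 2)%:E * (\1_[set s | (s ^+ 2 < c - b)%R] s * h s)%:E)%E.
  under eq_integral do rewrite KE EFinM.
  rewrite integralZl//.
    by rewrite integral_abel// indicE' -EFinM; congr EFin; ring.
  apply/integrableP; split; first by apply/measurable_EFinP; exact: ma.
  under eq_integral.
    move=> r _; rewrite /= ger0_norm; last first.
      by rewrite mulr_ge0 ?abel_weight_ge0 ?invsqrt_ge0.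
    over.
  by rewrite integral_abel// ltry.
have K_abs s : (\int[mu]_r `|(K (r, s))%:E| =
    (pi / 2)%:E * `|(\1_[set s | (s ^+ 2 < c - b)%R] s * h s)%:E|)%E.
  under eq_integral.
    move=> r _; rewrite KE /= normrM [X in _ * X]ger0_norm; last first.
      by rewrite mulr_ge0 ?abel_weight_ge0 ?invsqrt_ge0.
    rewrite EFinM; over.
  rewrite ge0_integralZl//.
  - rewrite integral_abel// indicE' /= -!EFinM normrM [X in _ = (_ * (X * _))%:E]ger0_norm //.
    by congr EFin; ring.
  - by apply/measurable_EFinP; exact: ma.
  - by move=> r _; rewrite lee_fin mulr_ge0 ?abel_weight_ge0 ?invsqrt_ge0.
have intI : mu.-integrable setT
    (fun s => (\1_[set s | (s ^+ 2 < c - b)%R] s * h s)%:E).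
  exact: integrable_indicM (measurable_sqr_lt _) inth.
have intK : (mu \x mu)%E.-integrable setT (EFin \o K).
  apply/integrable21ltyP; first exact/measurable_EFinP.
  rewrite [X in (X < _)%E](_ : _ = \int[mu]_s ((pi / 2)%:E *
    `|(\1_[set s | (s ^+ 2 < c - b)%R] s * h s)%:E|))%E; last first.
    by apply: eq_integral => s _; exact: K_abs.
  have /integrableP[mI fI] := intI.
  rewrite ge0_integralZl//; last 2 first.
  - exact: measurableT_comp.
  - by rewrite lee_fin ltW.
  by rewrite lte_mul_pinfty// lee_fin ltW.
have E1 : (\int[mu]_r \int[mu]_s (EFin \o K) (r, s) = 0)%E.
  transitivity (\int[mu]_r (cst 0 r : \bar R))%E; last exact: integral0.
  apply: ae_eq_integral => //.
    exact: (measurable_fubini_F intK).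
  have := ae_integrable1 intK.
  move: H; apply: filterS2; first exact: (ae_filter_ringOfSetsType mu).
  move=> r Hr intKr _ /=.
  have [w0|w0] := eqVneq (abel_weight b r) 0.
    by rewrite integral0_eq// => s _; rewrite /K/= w0 !mul0r.
  have r0 : 0 < r.
    by move: w0; rewrite /abel_weight; case: ifP => //; rewrite eqxx.
  have : (\int[mu]_s ((abel_weight b r)^-1%:E * (K (r, s))%:E) = 0)%E.
    rewrite -[RHS](Hr r0); apply: eq_integral => s _.
    by rewrite -EFinM /K/= -mulrA mulKf.
  rewrite integralZl// => /eqP; rewrite mule_eq0 eqe invr_eq0 (negbTE w0)/=.
  by move=> /eqP.
have E2 : (\int[mu]_s \int[mu]_r (EFin \o K) (r, s) = 0)%E.
  by rewrite -(Fubini intK).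
have : (\int[mu]_s ((pi / 2)%:E * (\1_[set s | (s ^+ 2 < c - b)%R] s * h s)%:E) = 0)%E.
  by rewrite -E2; apply: eq_integral => s _; exact/esym/K_int.
rewrite integralZl// => /eqP; rewrite mule_eq0 eqe gt_eqF//= => /eqP.
exact.
Qed.

End abel_inversion.

(** * Slices of a square integrable function on the ball *)

(** The bound [v <= 1 + v^2] replaces the Cauchy-Schwarz inequality. *)
Lemma L2_ball_integrable (R : realType) (n : nat) (g : n.-tuple R -> R) :
  L2_ball g -> (lebesgue_tuple R n).-integrable setT (EFin \o (g \_ unit_ball)).
Proof.
move=> gL2; have mg : measurable_fun setT (g \_ unit_ball).
  by have := sub_Lfun_mfun gL2; rewrite inE.
have ig2 := Lfun2_integrable_sqr gL2.
have mB := @measurable_unit_ball R n.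
have iB : (lebesgue_tuple R n).-integrable setT (EFin \o \1_unit_ball).
  apply/integrableP; split; first by apply/measurable_EFinP; exact: measurable_indic.
  under eq_integral do rewrite gee0_abs ?lee_fin//.
  by rewrite (integral_indicT _ _ _ _ _ mB) ball_lty.
apply: le_integrable (integrableD measurableT iB ig2) => //.
  exact/measurable_EFinP.
move=> x _ /=; rewrite lee_fin [leRHS]ger0_norm ?addr_ge0 ?sqr_ge0//.
rewrite patchE indicE; case: (x \in unit_ball); last first.
  by rewrite (_ : point = 0 :> R)// normr0 add0r sqr_ge0.
rewrite -[g x ^+ 2]real_normK ?num_real//.
have := normr_ge0 (g x); move: `|g x| => v v0.
rewrite (_ : true%:R = 1)//.
have := sqr_ge0 (v - 1 / 2); nra.
Qed.

Lemma integralZ_gt0 d (T : measurableType d) (R : realType)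
    (mu : {measure set T -> \bar R}) (k : R) (f : T -> \bar R) : 0 < k ->
  measurable_fun setT f ->
  (\int[mu]_x (k%:E * f x) = k%:E * \int[mu]_x f x)%E.
Proof.
move=> k0 mf.
rewrite integralE [in RHS]integralE ge0_funeposM ?ge0_funenegM ?(ltW k0)//.
rewrite ge0_integralZl//; last 2 first.
- exact: measurable_funepos.
- by rewrite lee_fin ltW.
rewrite ge0_integralZl//; last 2 first.
- exact: measurable_funeneg.
- by rewrite lee_fin ltW.
by apply/esym/gt0_muleB => //; exact: integral_ge0.
Qed.

Section splice_ball.
Context {R : realType} {n : nat} (g : n.-tuple R -> R) (a : {set 'I_n}).
Context (gL2 : L2_ball g).
Notation G := (g \_ unit_ball).
Notation p := #|a|.
Notation q := #|~: a|.

Lemma measurable_restrict_ball : measurable_fun setT G.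
Proof.
by have /measurable_EFinP := measurable_int _ (L2_ball_integrable _ _ _ gL2).
Qed.

Lemma restrict_ball_out (x : n.-tuple R) : 1 < enorm x ^+ 2 -> G x = 0.
Proof.
move=> x1; rewrite patchE memNset// unit_ballE.
by apply/negP; rewrite -ltNge.
Qed.

Lemma restrict_ball_in (x : n.-tuple R) : enorm x ^+ 2 <= 1 -> G x = g x.
Proof. by move=> x1; rewrite patchE mem_set// unit_ballE. Qed.

Lemma measurable_G_splice (y : p.-tuple R) :
  measurable_fun setT (fun z : q.-tuple R => G (splice y z)).
Proof.
exact: (measurableT_comp measurable_restrict_ball (measurable_splicer a y)).
Qed.

Lemma integral_ballE (y : p.-tuple R) (c : R) (w : q.-tuple R -> R) :
  0 <= c -> enorm y ^+ 2 + c ^+ 2 <= 1 ->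
  (\int[lebesgue_tuple R q]_(x in unit_ball) (w x * g (splice y (dilate c x)))%:E
  = \int[lebesgue_tuple R q]_x (\1_unit_ball x * w x * G (splice y (dilate c x)))%:E)%E.
Proof.
move=> c0 yc; rewrite integral_mkcond; apply: eq_integral => x _.
rewrite patchE indicE; case: ifPn => [|_]; last by rewrite !mul0r.
rewrite inE unit_ballE => x1; rewrite mul1r restrict_ball_in// enorm_splice enorm_dilate.
by apply: le_trans yc; rewrite lerD2l ler_piMr// sqr_ge0.
Qed.

(** On the unit sphere both sides vanish, because [0 `^ (- 1 / 2) = 0]. *)
Lemma ball_powR_invsqrt (x : q.-tuple R) :
  \1_unit_ball x * (1 - enorm x ^+ 2) `^ ((-1)%:~R / 2) = invsqrt (1 - enorm x ^+ 2).
Proof.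
rewrite indicE; have [x1|x1] := leP (enorm x ^+ 2) 1.
  rewrite mem_set ?unit_ballE// mul1r /invsqrt mulNr mul1r powRN.
  by rewrite powR12_sqrt// subr_ge0.
rewrite memNset ?unit_ballE ?mul0r; last by apply/negP; rewrite -ltNge.
by rewrite invsqrt_le0// subr_le0 ltW.
Qed.

Lemma integrable_G2 :
  (lebesgue_tuple R p \x lebesgue_tuple R q)%E.-integrable setT
    (fun yz => (G (splice yz.1 yz.2))%:E).
Proof.
have /integrableP[mG iG] := L2_ball_integrable _ _ _ gL2.
apply/integrable12ltyP.
  exact: (measurableT_comp mG (measurable_splice a)).
rewrite (ge0_integral_splice a) in iG => //.
exact: measurableT_comp.
Qed.

Lemma ae_integrable_G : {ae lebesgue_tuple R p, forall y,
  (lebesgue_tuple R q).-integrable setT (fun z => (G (splice y z))%:E)}.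
Proof. exact: (ae_integrable1 integrable_G2). Qed.

Lemma integrable_dilate (k : nat) (c : R) (f : k.-tuple R -> R) : 0 < c ->
  (lebesgue_tuple R k).-integrable setT (EFin \o f) ->
  (lebesgue_tuple R k).-integrable setT (fun x => (f (dilate c x))%:E).
Proof.
move=> c0 /integrableP[mf intf]; apply/integrableP; split.
  exact: (measurableT_comp mf (measurable_dilate k c)).
rewrite ltNge leye_eq; apply/negP => /eqP foo.
move: intf; rewrite (ge0_integral_dilate _ c)//; last exact: measurableT_comp.
rewrite [X in (_ * X)%E]foo gt0_muley ?ltxx// lte_fin.
by rewrite exprn_gt0.
Qed.

(** For almost every [y], Tonelli and the Abel integral bound the double integral
in [(r, z)] by pi/2 times the mass of the slice. The exceptional set is a set of
pairs [(y, r)], whose measurability is needed to conclude. *)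
Lemma ae_abel_integrable :
  {ae (lebesgue_tuple R p \x lebesgue_measure)%E, forall yr, 0 < yr.2 ->
    (lebesgue_tuple R q).-integrable setT (fun z =>
      (invsqrt (1 - enorm yr.1 ^+ 2 - yr.2 ^+ 2 - enorm z ^+ 2) *
       G (splice yr.1 z))%:E)}.
Proof.
have p0 : 0 < pi / 2 :> R by rewrite divr_gt0 ?pi_gt0.
pose K (t : (p.-tuple R * measurableTypeR R) * q.-tuple R) : R :=
  abel_weight 0 t.1.2 *
  invsqrt (1 - enorm t.1.1 ^+ 2 - t.1.2 ^+ 2 - enorm t.2 ^+ 2) *
  G (splice t.1.1 t.2).
have mK : measurable_fun setT K.
  have m11 : measurable_fun setT
      (fun t : (p.-tuple R * measurableTypeR R) * q.-tuple R => t.1.1).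
    exact: measurableT_comp measurable_fst measurable_fst.
  have m12 : measurable_fun setT
      (fun t : (p.-tuple R * measurableTypeR R) * q.-tuple R => t.1.2).
    exact: measurableT_comp measurable_snd measurable_fst.
  apply: measurable_funM; first apply: measurable_funM.
  - exact: (measurableT_comp (measurable_abel_weight 0) m12).
  - apply: (measurableT_comp (measurable_invsqrt R)).
    apply: measurable_funB; first apply: measurable_funB; first apply: measurable_funB => //.
    + exact: (measurableT_comp (measurable_enorm_sqr p) m11).
    + exact: (measurableT_comp (exprn_measurable _) m12).
    + exact: (measurableT_comp (measurable_enorm_sqr q) measurable_snd).
  - apply: (measurableT_comp measurable_restrict_ball).
    apply: (measurableT_comp (measurable_splice a)
      (_ : measurable_fun setT (fun t : (p.-tuple R * measurableTypeR R) * q.-tuple R =>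
        (t.1.1, t.2)))).
    by apply/measurable_fun_pairP; split => //=; exact: measurable_snd.
have mKa : measurable_fun setT (fun t => `|(K t)%:E|)%E.
  by apply: measurableT_comp => //; exact/measurable_EFinP.
have mPsi := measurable_fun_fubini_tonelli_F (m2 := lebesgue_tuple R q) _ mKa
  (fun x => abse_ge0 _).
pose B := fubini_F (lebesgue_tuple R q) (fun t => `|(K t)%:E|)%E @^-1` [set +oo%E].
have mB : measurable B.
  by rewrite -[X in measurable X]setTI; apply: mPsi => //; exact: emeasurable_set1.
suff B0 : (lebesgue_tuple R p \x lebesgue_measure)%E B = 0%E.
  exists B; split => // -[y r]; apply: contra_notP => /= nB r0.
  apply/integrableP; split.
    apply/measurable_EFinP; apply: measurable_funM; last exact: measurable_G_splice.
    apply: (measurableT_comp (measurable_invsqrt R)).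
    by apply: measurable_funB => //; exact: measurable_enorm_sqr.
  rewrite ltey; apply/eqP => Kinf; apply: nB; rewrite /B/= -Kinf /fubini_F.
  by apply: eq_integral => z _; rewrite /K/= abel_weight0// mul1r.
apply/product_measure_eq0 => //; apply: filterS ae_integrable_G => y intGy.
have mKy : measurable_fun setT (fun rz : measurableTypeR R * q.-tuple R =>
    K ((y, rz.1), rz.2)).
  apply: (measurableT_comp mK
    (_ : measurable_fun setT (fun rz : measurableTypeR R * q.-tuple R =>
      ((y, rz.1), rz.2)))).
  apply/measurable_fun_pairP; split => /=; last exact: measurable_snd.
  apply/measurable_fun_pairP; split => /=; last exact: measurable_fst.
  exact: measurable_cst.
have intKy : (lebesgue_measure \x lebesgue_tuple R q)%E.-integrable setT
    (fun rz : measurableTypeR R * q.-tuple R => (K ((y, rz.1), rz.2))%:E).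
  apply/integrable21ltyP; first exact/measurable_EFinP.
  have /integrableP[mG iG] := intGy.
  apply: (@le_lt_trans _ _ ((pi / 2)%:E *
    \int[lebesgue_tuple R q]_z `|(G (splice y z))%:E|))%E; last first.
    by rewrite lte_mul_pinfty// lee_fin ltW.
  rewrite -ge0_integralZl//; last 2 first.
  - exact: measurableT_comp.
  - by rewrite lee_fin ltW.
  apply: ge0_le_integral => //.
  - by move=> z _; exact: integral_ge0.
  - apply: (measurable_fun_fubini_tonelli_G (m1 := lebesgue_measure)
      (fun rz : measurableTypeR R * q.-tuple R => `|(K ((y, rz.1), rz.2))%:E|%E)) => //.
    by apply: measurableT_comp => //; exact/measurable_EFinP.
  - by apply: measurable_funeM; exact: measurableT_comp.
  move=> z _; rewrite [leLHS](_ : _ = \int[lebesgue_measure]_r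
     (`|G (splice y z)|%:E * (abel_weight 0 r *
       invsqrt ((1 - enorm y ^+ 2 - enorm z ^+ 2) - r ^+ 2))%:E))%E; last first.
    apply: eq_integral => r _; rewrite /K/= -EFinM normrM mulrC; congr (_ * _)%:E.
    rewrite ger0_norm ?mulr_ge0 ?abel_weight_ge0 ?invsqrt_ge0//.
    by congr (_ * invsqrt _); ring.
  rewrite ge0_integralZl//; last 2 first.
  - apply/measurable_EFinP; apply: measurable_funM.
      exact: measurable_abel_weight.
    apply: (measurableT_comp (measurable_invsqrt R)).
    by apply: measurable_funB => //; exact: exprn_measurable.
  - by move=> r _; rewrite lee_fin mulr_ge0 ?abel_weight_ge0 ?invsqrt_ge0.
  rewrite integral_abel// -EFinM lee_fin mulrC.
  by apply: ler_wpM2r => //; case: ifP => // _; exact: ltW.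
have := ae_integrable1 intKy.
apply: filterS => r /integrableP[_ fin]; rewrite /B/= /fubini_F => Kinf.
by move: fin; rewrite Kinf ltxx.
Qed.

End splice_ball.

(** * From oddness to the integral conditions *)

Section directions.
Context {R : realType} {n : nat} (g : n.-tuple R -> R).
Context (gL2 : L2_ball g).
Notation G := (g \_ unit_ball).

Lemma mem_unit_ball k (x : k.-tuple R) : (x \in unit_ball) = (enorm x ^+ 2 <= 1).
Proof. by apply/idP/idP; rewrite in_setE unit_ballE. Qed.

Definition odd_ae (i : 'I_n) :=
  {ae lebesgue_tuple R n, forall x, unit_ball x -> g x = - g (flip i x)}.

Lemma odd_ae_restrict i : odd_ae i ->
  {ae lebesgue_tuple R n, forall x, G x = - G (flip i x)}.
Proof.
apply: filterS => x gx; have [x1|x1] := leP (enorm x ^+ 2) 1.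
  by rewrite !restrict_ball_in ?enorm_flip// gx// unit_ballE.
by rewrite !restrict_ball_out ?enorm_flip// oppr0.
Qed.

Section slice.
Context (a : {set 'I_n}) (i : 'I_n).
Context (ia : i \notin a).
Notation p := #|a|.
Notation q := #|~: a|.

(** The weight is radial and dilations commute with reflections, so the integrand
inherits the antisymmetry of the slice. *)
Lemma flip_integral0 (y : p.-tuple R) (c : R) (w : R -> R) : 0 < c ->
  enorm y ^+ 2 + c ^+ 2 <= 1 ->
  {ae lebesgue_tuple R q, forall z,
     G (splice y z) = - G (flip i (splice y z))} ->
  (lebesgue_tuple R q).-integrable setT (fun x =>
    (\1_unit_ball x * w (enorm x ^+ 2) * G (splice y (dilate c x)))%:E) ->
  (0 = \int[lebesgue_tuple R q]_(x in unit_ball)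
    (w (enorm x ^+ 2) * g (splice y (dilate c x)))%:E)%E.
Proof.
move=> c0 yc Gi intG.
rewrite (integral_ballE g a y c (fun x => w (enorm x ^+ 2)) (ltW c0) yc).
have [j flipE] := @flip_splice R n a i ia.
apply/esym; apply: (integral_antisym q j (fun x =>
  \1_unit_ball x * w (enorm x ^+ 2) * G (splice y (dilate c x)))) => //.
apply: filterS (ae_dilate _ _ _ _ c0 Gi) => x Gx.
rewrite Gx flipE -[_ * - _]/(_ * - _) mulrN !indicE enorm_flip.
have -> : flip j (dilate c x) = dilate c (flip j x).
  apply: eq_from_tnth => k; rewrite !tnth_mktuple.
  by case: eqP => // _; rewrite mulrN.
by rewrite !mem_unit_ball enorm_flip.
Qed.

Lemma integrable_powR (y : p.-tuple R) (c e : R) : 0 < c -> 0 <= e ->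
  (lebesgue_tuple R q).-integrable setT (fun z => (G (splice y z))%:E) ->
  (lebesgue_tuple R q).-integrable setT (fun x =>
    (\1_unit_ball x * (1 - enorm x ^+ 2) `^ e * G (splice y (dilate c x)))%:E).
Proof.
move=> c0 e0 intG.
apply: (integrable_weight _ _ _ _
  (fun x => \1_unit_ball x * (1 - enorm x ^+ 2) `^ e)
  (fun x => G (splice y (dilate c x)))).
- apply: measurable_funM.
    by apply: measurable_indic; exact: measurable_unit_ball.
  apply: (measurableT_comp (measurable_powR e)).
  by apply: measurable_funB => //; exact: measurable_enorm_sqr.
- move=> x; rewrite indicE; have [x1|x1] := leP (enorm x ^+ 2) 1.
    rewrite mem_set ?unit_ballE// mul1r ger0_norm ?powR_ge0//.
    apply: (@le_trans _ _ (1 `^ e)); last by rewrite powR1.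
    by rewrite ge0_ler_powR ?nnegrE ?subr_ge0// gerBl sqr_ge0.
  rewrite memNset ?mul0r ?normr0//.
  by rewrite unit_ballE; apply/negP; rewrite -ltNge.
- exact: (integrable_dilate q c (fun z => G (splice y z)) c0 intG).
Qed.

(** The weight [(1 - |x|^2)^(-1/2)] at [x] is [c] times the weight
[(c^2 - |z|^2)^(-1/2)] at [z = c x]. *)
Lemma integrable_invsqrt (y : p.-tuple R) (c : R) : 0 < c ->
  (lebesgue_tuple R q).-integrable setT (fun z =>
    (invsqrt (c ^+ 2 - enorm z ^+ 2) * G (splice y z))%:E) ->
  (lebesgue_tuple R q).-integrable setT (fun x =>
    (\1_unit_ball x * (1 - enorm x ^+ 2) `^ ((-1)%:~R / 2) *
     G (splice y (dilate c x)))%:E).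
Proof.
move=> c0 intG; have cI := integrableZl measurableT c
  (integrable_dilate q c (fun z => invsqrt (c ^+ 2 - enorm z ^+ 2) * G (splice y z)) c0 intG).
apply: eq_integrable cI => // x _; rewrite -EFinM; congr EFin.
rewrite ball_powR_invsqrt enorm_dilate mulrA; congr (_ * _).
by rewrite -[X in X - _]mulr1 -mulrBr invsqrt_scale.
Qed.

Lemma odd_ae_slice : odd_ae i ->
  {ae lebesgue_tuple R p, forall y,
    {ae lebesgue_tuple R q, forall z,
       G (splice y z) = - G (flip i (splice y z))} /\
    (lebesgue_tuple R q).-integrable setT (fun z => (G (splice y z))%:E)}.
Proof.
move=> /odd_ae_restrict/(ae_splice a) Gi.
by move: Gi (ae_integrable_G g a gL2); apply: filterS2 => y; split.
Qed.

End slice.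

Lemma odd_conditions d : (n < d)%N -> (forall i, odd_ae i) ->
  ((forall a : {set 'I_n}, a \proper [set: 'I_n]%SET ->
      {ae lebesgue_tuple R #|a|, forall y, unit_ball y ->
        (0 = \int[lebesgue_tuple R #|~: a|]_(x in unit_ball)
          ((1 - enorm x ^+ 2) `^ ((d%:R - n%:R - 1) / 2) *
           g (splice y (dilate (Num.sqrt (1 - enorm y ^+ 2)) x)))%:E)%E})
   /\
   (forall (a : {set 'I_n}) (m : int), a \proper [set: 'I_n]%SET ->
      -1 <= m <= d%:Z - n%:Z - 2 ->
      {ae (lebesgue_tuple R #|a| \x lebesgue_measure)%E, forall yr,
        unit_ball yr.1 -> 0 <= yr.2 <= Num.sqrt (1 - enorm yr.1 ^+ 2) ->
        (0 = (Num.sqrt (1 - enorm yr.1 ^+ 2 - yr.2 ^+ 2))%:E *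
          \int[lebesgue_tuple R #|~: a|]_(x in unit_ball)
            ((1 - enorm x ^+ 2) `^ (m%:~R / 2) *
             g (splice yr.1
               (dilate (Num.sqrt (1 - enorm yr.1 ^+ 2 - yr.2 ^+ 2)) x)))%:E)%E})).
Proof.
move=> nd godd; split=> [a|a m] /properP[_ [i _ ia]].
  have ySp : {ae lebesgue_tuple R #|a|, forall y, enorm y ^+ 2 <> 1}.
    exists [set y | enorm y ^+ 2 = 1]; split.
    - rewrite (_ : mkset _ = (fun x => enorm x ^+ 2) @^-1` [set 1])//.
      by rewrite -[X in measurable X]setTI; exact: measurable_enorm_sqr.
    - exact: sphere_null.
    - by move=> y /= /notP.
  move: ySp (odd_ae_slice a i (godd i)); apply: filterS2 => y y1 [Gi intG] yB.
  have {}y1 : 0 < 1 - enorm y ^+ 2.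
    by rewrite subr_gt0 lt_neqAle; move: yB; rewrite unit_ballE => ->; rewrite andbT; apply/eqP.
  apply: (flip_integral0 a i ia y _ (fun v => (1 - v) `^ ((d%:R - n%:R - 1) / 2))) => //.
  - by rewrite sqrtr_gt0.
  - by rewrite [Num.sqrt (_ - _) ^+ 2]sqr_sqrtr ?(ltW y1)// addrCA subrr addr0.
  - apply: integrable_powR => //; first by rewrite sqrtr_gt0.
    rewrite divr_ge0// -addrA -opprD subr_ge0 natr1 ler_nat.
    exact: nd.
move=> /andP[m1 _].
have slices := ae_product_fst (@lebesgue_measure R) (odd_ae_slice a i (godd i)).
have r0 : {ae (lebesgue_tuple R #|a| \x @lebesgue_measure R)%E, forall yr, yr.2 <> 0}.
  exists (setT `*` [set 0]); split.
  - exact: measurableX.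
  - by rewrite product_measure1E//= lebesgue_measure_set1 mule0.
  - by move=> yr /= /notP.
move: slices r0 (ae_abel_integrable g a gL2); apply: filterS3.
move=> [y r] /= [Gi intG] /eqP r0 abel yB /andP[r1 r2].
have cr : 0 <= 1 - enorm y ^+ 2 - r ^+ 2.
  have yB' : 0 <= 1 - enorm y ^+ 2 by rewrite subr_ge0 -unit_ballE.
  by rewrite subr_ge0 -(sqr_sqrtr yB') ler_pXn2r// nnegrE sqrtr_ge0.
have [c0|c0] := eqVneq (Num.sqrt (1 - enorm y ^+ 2 - r ^+ 2)) 0.
  by rewrite c0 mul0e.
have {}c0 : 0 < Num.sqrt (1 - enorm y ^+ 2 - r ^+ 2) by rewrite lt_neqAle eq_sym c0 sqrtr_ge0.
rewrite -(flip_integral0 a i ia y _ (fun v => (1 - v) `^ (m%:~R / 2))) ?mule0//.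
  rewrite [Num.sqrt (_ - _) ^+ 2]sqr_sqrtr// addrA addrCA subrr addr0.
  by rewrite gerBl sqr_ge0.
have [m0|m0] := leP 0 m.
  by apply: integrable_powR => //; rewrite divr_ge0// ler0z.
have -> : m = -1.
  by apply/eqP; rewrite eq_le m1 andbT -ltzD1 addNr.
apply: integrable_invsqrt => //; rewrite [Num.sqrt (_ - _) ^+ 2]sqr_sqrtr//.
by apply: abel; rewrite lt_neqAle eq_sym r0.
Qed.

End directions.

(** * From the integral conditions to oddness *)

Section converse.
Context {R : realType} {n : nat} (g : n.-tuple R -> R).
Context (gL2 : L2_ball g).
Notation G := (g \_ unit_ball).
Context (i : 'I_n).
Notation a := (~: [set i]).
Notation p := #|a|.
Notation q := #|~: a|.

Let q1 : q = 1%N. Proof. by rewrite finset.setCK cards1. Qed.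

(** The point [s] of the line orthogonal to the [a]-coordinates. *)
Let line (s : R) : q.-tuple R := [tuple s | _ < q].

Lemma enorm_const_tuple (s : R) : enorm (line s) ^+ 2 = s ^+ 2.
Proof.
rewrite enorm_sqr (eq_bigr (fun=> s ^+ 2)); last by move=> j _; rewrite tnth_mktuple.
by rewrite sumr_const card_ord q1.
Qed.

Lemma dilate_const_tuple (c s : R) : dilate c (line s) = line (c * s).
Proof. by apply: eq_from_tnth => j; rewrite !tnth_mktuple. Qed.

Section fiber.
Context (y : p.-tuple R).
Let h (s : R) : R := G (splice y (line s)).
Let c : R := 1 - enorm y ^+ 2.

Context (intG : (lebesgue_tuple R q).-integrable setT
  (fun z => (G (splice y z))%:E)).

Lemma fiber_integrable : lebesgue_measure.-integrable setT (EFin \o h).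
Proof.
have /integrableP[mG fG] := intG; apply/integrableP; split.
  exact: (measurableT_comp mG (measurable_const_tuple q)).
move: fG; rewrite (ge0_integral_tuple1 R q _ q1)//.
exact: measurableT_comp.
Qed.

Lemma fiber_measurable : measurable_fun setT h.
Proof. by have /measurable_EFinP := measurable_int _ fiber_integrable. Qed.

(** The substitution [s = rho * x] with [rho^2 = c - r^2] turns the weight on the
unit segment into the Abel kernel. *)
Lemma fiber_abel (r : R) : 0 < r ->
  (0 <= r <= Num.sqrt (1 - enorm y ^+ 2) ->
   (0 = (Num.sqrt (1 - enorm y ^+ 2 - r ^+ 2))%:E *
      \int[lebesgue_tuple R q]_(x in unit_ball)
        ((1 - enorm x ^+ 2) `^ ((-1)%:~R / 2) *
         g (splice y (dilate (Num.sqrt (1 - enorm y ^+ 2 - r ^+ 2)) x)))%:E)%E) ->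
  (\int[lebesgue_measure]_s (invsqrt (c - r ^+ 2 - s ^+ 2) * h s)%:E = 0)%E.
Proof.
move=> r0; have [cr|cr] := leP (c - r ^+ 2) 0 => H.
  rewrite integral0_eq// => s _; rewrite invsqrt_le0 ?mul0r//.
  by rewrite subr_le0 (le_trans cr) ?sqr_ge0.
have rc : 0 <= r <= Num.sqrt c.
  rewrite (ltW r0)/=; have c0 : 0 < c by have := sqr_ge0 r; lra.
  rewrite -(@ler_pXn2r _ 2)// ?nnegrE ?sqrtr_ge0 ?(ltW r0)// sqr_sqrtr ?(ltW c0)//.
  by rewrite -subr_ge0 ltW.
move: (H rc); rewrite -/c; set rho := Num.sqrt (c - r ^+ 2).
have rho0 : 0 < rho by rewrite sqrtr_gt0.
have rho2 : rho ^+ 2 = c - r ^+ 2 by rewrite sqr_sqrtr// ltW.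
rewrite (integral_ballE g a y rho (fun x => (1 - enorm x ^+ 2) `^ ((-1)%:~R / 2)) (ltW rho0)); last first.
  by rewrite rho2 /c addrA addrCA subrr addr0 gerBl sqr_ge0.
move=> /esym/eqP; rewrite mule_eq0 eqe gt_eqF//= => /eqP.
under eq_integral do rewrite ball_powR_invsqrt.
have mw k : measurable_fun setT (fun x : k.-tuple R => invsqrt (1 - enorm x ^+ 2)).
  apply: (measurableT_comp (measurable_invsqrt R)).
  by apply: measurable_funB => //; exact: measurable_enorm_sqr.
have mf : measurable_fun setT (fun x : q.-tuple R =>
    (invsqrt (1 - enorm x ^+ 2) * G (splice y (dilate rho x)))%:E).
  apply/measurable_EFinP; apply: measurable_funM; first exact: mw.
  exact: (measurableT_comp (measurable_G_splice g a gL2 y) (measurable_dilate q rho)).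
rewrite (integral_tuple1 q _ q1 mf) => I0.
have mF : measurable_fun setT (fun s : R => invsqrt (c - r ^+ 2 - s ^+ 2) * h s).
  apply: measurable_funM; last exact: fiber_measurable.
  apply: (measurableT_comp (measurable_invsqrt R)).
  by apply: measurable_funB => //; exact: exprn_measurable.
have mFr : measurable_fun setT (fun s : R =>
    invsqrt (c - r ^+ 2 - (rho * s) ^+ 2) * h (rho * s)).
  exact: (measurableT_comp mF (measurable_mull R rho)).
rewrite (integral_scale rho (fun s => (invsqrt (c - r ^+ 2 - s ^+ 2) * h s)%:E))//; last first.
  exact/measurable_EFinP.
rewrite -integralZ_gt0//; last exact/measurable_EFinP.
rewrite -[RHS]I0; apply: eq_integral => s _.
rewrite -EFinM; congr EFin.
rewrite mulrA -rho2 exprMn -[X in X - _]mulr1 -mulrBr invsqrt_scale//.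
by rewrite enorm_const_tuple dilate_const_tuple.
Qed.

End fiber.

(** The slice [h] above [y] vanishes for [s^2 > c], and the two points [s^2 = c]
form a null set, so it is enough to treat [h] restricted to [s^2 < c]. *)
Lemma conditions_odd :
  {ae (lebesgue_tuple R p \x lebesgue_measure)%E, forall yr,
    unit_ball yr.1 -> 0 <= yr.2 <= Num.sqrt (1 - enorm yr.1 ^+ 2) ->
    (0 = (Num.sqrt (1 - enorm yr.1 ^+ 2 - yr.2 ^+ 2))%:E *
      \int[lebesgue_tuple R q]_(x in unit_ball)
        ((1 - enorm x ^+ 2) `^ ((-1)%:~R / 2) *
         g (splice yr.1
           (dilate (Num.sqrt (1 - enorm yr.1 ^+ 2 - yr.2 ^+ 2)) x)))%:E)%E} ->
  odd_ae g i.
Proof.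
move=> H; pose A := [set z | G z + G (flip i z) != 0].
have mG := measurable_restrict_ball g gL2.
have mA : measurable A.
  rewrite (_ : A = ~` ((fun z => G z + G (flip i z)) @^-1` [set 0])).
    apply: measurableC; rewrite -[X in measurable X]setTI.
    have mGG : measurable_fun setT (fun z => G z + G (flip i z)).
      apply: measurable_funD => //.
      exact: (measurableT_comp mG (measurable_flip n i)).
    exact: mGG.
  by apply/seteqP; split => z /= => [/eqP|/eqP].
suff A0 : lebesgue_tuple R n A = 0%E.
  exists A; split => // x; apply: contra_notP => /= /negP; rewrite negbK => Gx.
  rewrite unit_ballE => x1; move: Gx; rewrite !restrict_ball_in ?enorm_flip//.
  by rewrite addr_eq0 => /eqP.
apply: (splice_null a) => //.
move: (ae_product H) (ae_integrable_G g a gL2); apply: filterS2 => y Hy intG.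
have mAy : measurable ((fun z : q.-tuple R => splice y z) @^-1` A).
  by rewrite -[X in measurable X]setTI; exact: measurable_splicer.
apply: (ae_tuple1 q _ q1 mAy).
pose h (s : R) := G (splice y (line s)); pose c := 1 - enorm y ^+ 2.
have hA s : A (splice y (line s)) -> h s + h (- s) != 0.
  by rewrite /A/= flip_splice_const.
have h0 s : c < s ^+ 2 -> h s = 0.
  move=> cs; apply: restrict_ball_out; rewrite enorm_splice enorm_const_tuple.
  by move: cs; rewrite /c; lra.
have [y1|y1] := leP (enorm y ^+ 2) 1; last first.
  apply: aeW => s /hA; rewrite !h0 ?addr0 ?eqxx// ?sqrrN.
    by rewrite (lt_le_trans _ (sqr_ge0 s))// subr_lt0.
  by rewrite (lt_le_trans _ (sqr_ge0 s))// subr_lt0.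
have inth := fiber_integrable y intG.
have ah : {ae lebesgue_measure, forall r, 0 < r ->
    (\int[lebesgue_measure]_s (invsqrt (c - r ^+ 2 - s ^+ 2) * h s)%:E = 0)%E}.
  move: Hy; apply: filterS => r Hr r0.
  apply: (fiber_abel y intG r r0).
  by apply: Hr; rewrite /= unit_ballE.
have inthc := integrable_indicM _ _ _ _ _ _ (measurable_sqr_lt c) inth.
have := ae_odd _ inthc.
have cE t : (\int[lebesgue_measure]_s (\1_[set s | (s ^+ 2 < t)%R] s *
    (\1_[set s | (s ^+ 2 < c)%R] s * h s))%:E = 0)%E.
  (* the segment s^2 < min t c is s^2 < c - b for this b, which must be >= 0 *)
  have b0 : 0 <= Order.max (c - t) 0 by rewrite le_max lexx orbT.
  rewrite -[RHS](abel_inversion h c inth ah _ b0).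
  apply: eq_integral => s _; rewrite mulrA; congr (_ * _)%:E.
  rewrite !indicE -natrM mulnb; congr (nat_of_bool _)%:R.
  by apply/idP/idP; rewrite ?inE/= sub_max_min lt_min => /andP[st sc];
    apply/andP; move: st sc; rewrite ?inE.
have c0 : lebesgue_measure [set s : measurableTypeR R | s ^+ 2 = c] = 0%E.
  exact: sqr_null.
have ac : {ae lebesgue_measure, forall s : R, s ^+ 2 <> c}.
  exists [set s | s ^+ 2 = c]; split => //; last by move=> s /= /notP.
  rewrite (_ : mkset _ = (fun s : measurableTypeR R => s ^+ 2 : measurableTypeR R) @^-1` [set c])//.
  by rewrite -[X in measurable X]setTI; exact: exprn_measurable.
move=> /(_ cE); move: ac.
apply: filterS2; first exact: (ae_filter_ringOfSetsType lebesgue_measure).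
move=> s sc hs /hA; apply/negP; rewrite negbK.
have [sc'|sc'|//] := ltgtP (s ^+ 2) c; last by rewrite !h0 ?sqrrN ?addr0.
move: hs; rewrite !indicE !mem_set/= ?sqrrN// !mul1r => /eqP.
exact.
Qed.

End converse.

Theorem theorem3p8 (R : realType) (d n : nat) (n_ge1 : (1 <= n)%N)
    (n_lt_d : (n < d)%N) (g : n.-tuple R -> R) (gL2 : L2_ball g) :
  ((forall a : {set 'I_n}, a \proper [set: 'I_n]%SET ->
      {ae lebesgue_tuple R #|a|, forall y, unit_ball y ->
        (0 = \int[lebesgue_tuple R #|~: a|]_(x in unit_ball)
          ((1 - enorm x ^+ 2) `^ ((d%:R - n%:R - 1) / 2) *
           g (splice y (dilate (Num.sqrt (1 - enorm y ^+ 2)) x)))%:E)%E})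
   /\
   (forall (a : {set 'I_n}) (m : int), a \proper [set: 'I_n]%SET ->
      -1 <= m <= d%:Z - n%:Z - 2 ->
      {ae (lebesgue_tuple R #|a| \x lebesgue_measure)%E, forall yr,
        unit_ball yr.1 -> 0 <= yr.2 <= Num.sqrt (1 - enorm yr.1 ^+ 2) ->
        (0 = (Num.sqrt (1 - enorm yr.1 ^+ 2 - yr.2 ^+ 2))%:E *
          \int[lebesgue_tuple R #|~: a|]_(x in unit_ball)
            ((1 - enorm x ^+ 2) `^ (m%:~R / 2) *
             g (splice yr.1
               (dilate (Num.sqrt (1 - enorm yr.1 ^+ 2 - yr.2 ^+ 2)) x)))%:E)%E}))
  <->
  (forall i : 'I_n,
    {ae lebesgue_tuple R n, forall x, unit_ball x -> g x = - g (flip i x)}).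
Proof.
split=> [[_ H] i|godd]; last exact: odd_conditions.
apply: (conditions_odd g gL2 i); apply: H.
  by apply/properP; split; [exact: finset.subsetT|exists i; rewrite !inE ?eqxx].
by rewrite lexx/= lerBrDr lerBrDr -PoszD lez_nat add1n.
Qed.
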